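(* Let $k\in\mathbb N$, $0<\alpha\le1$ and $f\in\mathcal C^{k,\alpha}(\mathbb S^2)$. For $h\in\mathbb N$ let $\Omega_h:=\{n\in\mathbb Z\times\mathbb N_0: |n|\le h\}$ and $K_hf:=S_{\Omega_h}f$. Then there is a constant $M_{k,\alpha}$ depending only on $k$ and $\alpha$ such that for all $h\in\mathbb N$ $$\|f-K_hf\|_{\mathcal C(\mathbb S^2)}\le M_{k,\alpha}\,\|f\|_{\mathcal C^{k,\alpha}(\mathbb S^2)}\,h^{1-k-\alpha}.$$
   Context: $|n|$ is the Euclidean norm of $n\in\mathbb Z^2$; $\|g\|_{\mathcal C(\mathbb S^2)}=\sup_{\mathbb S^2}|g|$. $B^d_k:=\{\beta\in\mathbb N_0^d:\sum_i\beta_i\le k\}$. For open $U\subset\mathbb R^d$: $\mathcal C^k(U)$ bounded uniformly continuous complex functions whose classical derivatives $D^\beta f$, $\beta\in B^d_k$, are bounded and uniformly continuous; for $0<\alpha<1$, $\mathcal C^{k,\alpha}(U)$ those with finite $\sup\{|D^\beta f(x)-D^\beta f(y)|/\|x-y\|^\alpha:x\ne y,|\beta|=k\}$. Sphere: for $0\le\alpha<1$, $\|f\|_{\mathcal C^{k,\alpha}(\mathbb S^2)}$ is the infimum, over all $f^*\in\mathcal C^{k,\alpha}(U)$ with $U\supset\mathbb S^2$ open and $f^*|_{\mathbb S^2}=f$ ($\mathcal C^{k,0}=\mathcal C^k$), of $\sum_{\beta\in B^3_k}\sup_{\mathbb S^2}|D^\beta f^*|$ plus (if $\alpha>0$) $\sup\{|D^\beta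 f^*(\xi)-D^\beta f^*(\eta)|/\|\xi-\eta\|^\alpha:\xi\ne\eta\in\mathbb S^2,|\beta|=k\}$; $\mathcal C^{k,\alpha}(\mathbb S^2)$ is the set where it is finite. Convention: $\mathcal C^{k,1}(\mathbb S^2):=\mathcal C^{k+1}(\mathbb S^2)$ with the same norm. DFS: $\phi(\lambda,\theta)=(\cos\lambda\sin\theta,\sin\lambda\sin\theta,\cos\theta)$, $\tilde f=f\circ\phi$ on $\mathbb T^2=\mathbb R^2/(2\pi\mathbb Z^2)$, $\phi^{-1}$ inverse of the restriction of $\phi$ to $[-\pi,\pi)\times(0,\pi)\cup\{(0,0),(0,\pi)\}$. $c_n(g)=(2\pi)^{-2}\int_{\mathbb T^2}g(x)e^{-i\langle n,x\rangle}dx$. $M(n_1,n_2)=(n_1,-n_2)$; $e_n(x)=e^{i\langle n,x\rangle}+(-1)^{n_1}e^{i\langle M(n),x\rangle}$ if $n_2\ne0$, $e_n(x)=e^{i\langle n,x\rangle}$ if $n_2=0$; $b_n=e_n\circ\phi^{-1}$; $S_\Omega f(\xi)=\sum_{n\in\Omega}c_n(\tilde f)b_n(\xi)$ for finite $\Omega\subset\mathbb Z\times\mathbb N_0$. *)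

(* Defs.v *)
From Stdlib Require Import Reals Lra Lia List ZArith ClassicalEpsilon.
From Coquelicot Require Import Coquelicot.
Open Scope R_scope.

Definition R3 := (R * R * R)%type.

Definition dist3 (x y : R3) : R :=
  match x, y with
  | (x1, x2, x3), (y1, y2, y3) => sqrt ((x1 - y1)^2 + (x2 - y2)^2 + (x3 - y3)^2)
  end.

Definition sphere (x : R3) : Prop :=
  match x with (x1, x2, x3) => x1^2 + x2^2 + x3^2 = 1 end.

Definition open3 (U : R3 -> Prop) : Prop :=
  forall x, U x -> exists eps, 0 < eps /\ forall y, dist3 x y < eps -> U y.

Inductive axis := Ax1 | Ax2 | Ax3.

Definition shift (a : axis) (t : R) (x : R3) : R3 :=
  match x with
  | (x1, x2, x3) =>
    match a with
    | Ax1 => (x1 + t, x2, x3)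
    | Ax2 => (x1, x2 + t, x3)
    | Ax3 => (x1, x2, x3 + t)
    end
  end.

Definition pd (a : axis) (g : R3 -> C) (x : R3) : C :=
  (Derive (fun t => Re (g (shift a t x))) 0, Derive (fun t => Im (g (shift a t x))) 0).

Definition pd_exists (a : axis) (g : R3 -> C) (x : R3) : Prop :=
  ex_derive (fun t => Re (g (shift a t x))) 0 /\ ex_derive (fun t => Im (g (shift a t x))) 0.

Fixpoint Dl (l : list axis) (g : R3 -> C) : R3 -> C :=
  match l with
  | nil => g
  | a :: l' => pd a (Dl l' g)
  end.

Definition mindex := (nat * nat * nat)%type.
Definition mabs (b : mindex) : nat := match b with (b1, b2, b3) => (b1 + b2 + b3)%nat end.
Definition Dbeta (b : mindex) (g : R3 -> C) : R3 -> C :=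
  match b with (b1, b2, b3) => Dl (repeat Ax1 b1 ++ repeat Ax2 b2 ++ repeat Ax3 b3) g end.

Definition Bk (k : nat) : list mindex :=
  filter (fun b => Nat.leb (mabs b) k)
    (list_prod (list_prod (seq 0 (S k)) (seq 0 (S k))) (seq 0 (S k))).

Definition sumR (l : list R) : R := fold_right Rplus 0 l.

Definition bounded_unif_cont (U : R3 -> Prop) (h : R3 -> C) : Prop :=
  (exists M, forall x, U x -> Cmod (h x) <= M) /\
  (forall eps, 0 < eps -> exists delta, 0 < delta /\
     forall x y, U x -> U y -> dist3 x y < delta -> Cmod (Cminus (h x) (h y)) < eps).

Definition Ck (U : R3 -> Prop) (k : nat) (g : R3 -> C) : Prop :=
  forall l : list axis, (length l <= k)%nat ->
    bounded_unif_cont U (Dl l g) /\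
    ((length l < k)%nat -> forall a x, U x -> pd_exists a (Dl l g) x).

Definition Ckalpha (U : R3 -> Prop) (k : nat) (alpha : R) (g : R3 -> C) : Prop :=
  Ck U k g /\
  (0 < alpha -> forall b, In b (Bk k) -> mabs b = k ->
     exists Cst, forall x y, U x -> U y -> x <> y ->
       Cmod (Cminus (Dbeta b g x) (Dbeta b g y)) <= Cst * Rpower (dist3 x y) alpha).

Definition supR (P : R -> Prop) : R := real (Lub_Rbar P).

Definition ext_value (k : nat) (alpha : R) (fs : R3 -> C) : R :=
  sumR (map (fun b => supR (fun r => exists xi, sphere xi /\ r = Cmod (Dbeta b fs xi))) (Bk k))
  + (if Rlt_dec 0 alpha then
       supR (fun r => exists b xi eta, In b (Bk k) /\ mabs b = k /\
               sphere xi /\ sphere eta /\ xi <> eta /\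
               r = Cmod (Cminus (Dbeta b fs xi) (Dbeta b fs eta)) / Rpower (dist3 xi eta) alpha)
     else 0).

(* infimum over all extensions f* in C^{k,alpha}(U), U open containing S^2;
   p_infty if there is none *)
Definition norm_S2_raw (k : nat) (alpha : R) (f : R3 -> C) : Rbar :=
  Glb_Rbar (fun r => exists (U : R3 -> Prop) (fs : R3 -> C),
    open3 U /\ (forall x, sphere x -> U x) /\ Ckalpha U k alpha fs /\
    (forall x, sphere x -> fs x = f x) /\ r = ext_value k alpha fs).

(* convention C^{k,1}(S^2) := C^{k+1}(S^2) with the same norm *)
Definition norm_Ckalpha_S2 (k : nat) (alpha : R) (f : R3 -> C) : Rbar :=
  if Req_EM_T alpha 1 then norm_S2_raw (S k) 0 f else norm_S2_raw k alpha f.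

Definition in_Ckalpha_S2 (k : nat) (alpha : R) (f : R3 -> C) : Prop :=
  is_finite (norm_Ckalpha_S2 k alpha f).

Definition supnorm_S2 (g : R3 -> C) : R :=
  supR (fun r => exists xi, sphere xi /\ r = Cmod (g xi)).

Definition phi (p : R * R) : R3 :=
  let (l, th) := p in (cos l * sin th, sin l * sin th, cos th).

Definition phi_dom (p : R * R) : Prop :=
  (-PI <= fst p < PI /\ 0 < snd p < PI) \/ p = (0, 0) \/ p = (0, PI).

Definition phi_inv (xi : R3) : R * R :=
  epsilon (inhabits (0, 0)) (fun p => phi_dom p /\ phi p = xi).

Definition tilde (f : R3 -> C) : R * R -> C := fun p => f (phi p).

Definition cexpi (t : R) : C := (cos t, sin t).

Definition CRInt (g : R -> C) (a b : R) : C :=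
  (RInt (fun t => Re (g t)) a b, RInt (fun t => Im (g t)) a b).

Definition lattice := (Z * nat)%type.

Definition ip (n : lattice) (x : R * R) : R :=
  IZR (fst n) * fst x + INR (snd n) * snd x.

Definition cn (n : lattice) (g : R * R -> C) : C :=
  Cmult (RtoC (/ (2 * PI) ^ 2))
    (CRInt (fun x2 => CRInt (fun x1 => Cmult (g (x1, x2)) (cexpi (- ip n (x1, x2)))) 0 (2 * PI))
       0 (2 * PI)).


Definition e_n (n : lattice) (x : R * R) : C :=
  match snd n with
  | O => cexpi (ip n x)
  | S _ => Cplus (cexpi (ip n x))
             (Cmult (RtoC (powerRZ (-1) (fst n)))
                (cexpi (IZR (fst n) * fst x - INR (snd n) * snd x)))
  end.

Definition b_n (n : lattice) (xi : R3) : C := e_n n (phi_inv xi).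

(* S_Omega f for a finite Omega given as a duplicate-free list *)
Definition S_Omega (Om : list lattice) (f : R3 -> C) (xi : R3) : C :=
  fold_right Cplus (RtoC 0) (map (fun n => Cmult (cn n (tilde f)) (b_n n xi)) Om).

Definition Omega (h : nat) : list lattice :=
  filter (fun n => Z.leb (fst n * fst n + Z.of_nat (snd n) * Z.of_nat (snd n))
                         (Z.of_nat h * Z.of_nat h))
    (list_prod (map (fun i => (Z.of_nat i - Z.of_nat h)%Z) (seq 0 (2 * h + 1)))
               (seq 0 (h + 1))).

Definition K_h (h : nat) (f : R3 -> C) : R3 -> C := S_Omega (Omega h) f.

(* Main.v *)
(** Fourier coefficients of [f o phi] are controlled by finite differences.  If [f] has an
    extension of class C^(k,alpha), then along every circle of longitude or latitude the
    (k+1)-st difference of [f o phi] with step [t] is O(t^(k+alpha)).  Taking [t = 1/H], a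
    difference multiplies each coefficient [c_n] with H/2 < max(|n_1|,|n_2|) <= H by a factor
    bounded below, so Bessel's inequality bounds the l^2 norm of these coefficients by
    O(H^(-k-alpha)) and Cauchy-Schwarz over the O(H^2) lattice points bounds their l^1 norm by
    O(H^(1-k-alpha)).  Summing over H = 2^j h bounds the tail of the Fourier series, and Fejer's
    theorem identifies the sum of the series with [f o phi].  The convention for alpha = 1 is
    covered by running the argument with (k+1, 0) in place of (k, 1). *)

From Stdlib Require Import Reals Lra Lia List ZArith Permutation ClassicalEpsilon.
From Coquelicot Require Import Coquelicot.
Require Import Defs.
Open Scope R_scope.

(** * Smooth functions on the line and their differences *)

(** Only differences in one variable at a time are measured: a mode with large |n_1| is seen by
    differences in x_1, one with large |n_2| by differences in x_2. Hence no mixed derivative of f o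
    phi enters, and [phi] is used through the circles that it traces. Restricting an extension to
    such a circle needs the chain rule in R^3, which produces partial derivatives in every order,
    while the norm sees only the sorted ones; this is why Schwarz's theorem is needed on U.

    The set Omega_h lies in Z x N_0. The glide symmetry phi(x_1 + PI, -x_2) = phi(x_1, x_2) forces
    c_(m,-n) = (-1)^m c_(m,n), so each [e_n] with n_2 > 0 bundles two modes of the full lattice. The
    disc of radius h contains every mode with both |n_i| <= h/2, so all discarded modes have
    max(|n_1|,|n_2|) > h/2. The exponent 1-k-alpha is negative, which makes the dyadic sum
    geometric.

    No infinite series is formed: for fixed h the partial sum is compared with a double Fejer mean
    over a box of size N, under a tail bound independent of N, and then N grows. Fejer's theorem is
    needed for Lipschitz functions only, where it has an elementary explicit rate. *)

Lemma Rabs_diff_le_derive (u u' : R -> R) (B : R) :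
  (forall s, is_derive u s (u' s)) -> (forall s, Rabs (u' s) <= B) ->
  forall x y, Rabs (u y - u x) <= B * Rabs (y - x).
Proof.
  intros Hd HB x y.
  destruct (MVT_gen u x y u') as [c [_ Hc]].
  - intros; apply Hd.
  - intros z _. apply continuity_pt_filterlim, (ex_derive_continuous u z).
    exists (u' z); apply Hd.
  - rewrite Hc, Rabs_mult. apply Rmult_le_compat_r; [apply Rabs_pos | apply HB].
Qed.

Lemma le_Rpower_unit (t al : R) : 0 < t <= 1 -> al <= 1 -> t <= Rpower t al.
Proof.
  intros Ht Hal. rewrite <- (Rpower_1 t) at 1 by lra. unfold Rpower.
  assert (ln t <= 0) by (rewrite <- ln_1; apply ln_le; lra).
  assert (H1 : 1 * ln t <= al * ln t) by nra.
  destruct H1 as [H1|H1]; [left; apply exp_increasing; exact H1 | rewrite H1; lra].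
Qed.

(* For [al = 0] the condition on increments only says that [u] is bounded; this is the case used for C^(k,1). *)
Fixpoint smooth (al : R) (m : nat) (B : R) (u : R -> R) : Prop :=
  (forall s, Rabs (u s) <= B) /\
  match m with
  | O => forall s t, 0 < t <= 1 -> Rabs (u (s + t) - u s) <= B * Rpower t al
  | S m' => exists u', (forall s, is_derive u s (u' s)) /\ smooth al m' B u'
  end.

Lemma smooth_bound al m B u : smooth al m B u -> forall s, Rabs (u s) <= B.
Proof. destruct m; simpl; tauto. Qed.

Lemma smooth_nonneg al m B u : smooth al m B u -> 0 <= B.
Proof.
  intros H. apply Rle_trans with (Rabs (u 0)); [apply Rabs_pos | exact (smooth_bound _ _ _ _ H 0)].
Qed.

Lemma smooth_ext al m : forall B u v,
  (forall s, u s = v s) -> smooth al m B u -> smooth al m B v.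
Proof.
  destruct m as [|m]; simpl; intros B u v E [H1 H2]; split.
  - intros s; rewrite <- E; auto.
  - intros s t Ht; rewrite <- !E; auto.
  - intros s; rewrite <- E; auto.
  - destruct H2 as [u' [H2 H3]]. exists u'; split; [|exact H3].
    intros s. apply (is_derive_ext u); auto.
Qed.

Lemma smooth_weaken al m : forall B B' u, B <= B' -> smooth al m B u -> smooth al m B' u.
Proof.
  induction m as [|m IH]; simpl; intros B B' u HB [H1 H2]; (split; [intros s; specialize (H1 s); lra|]).
  - intros s t Ht. eapply Rle_trans; [apply H2, Ht|].
    apply Rmult_le_compat_r; [left; apply exp_pos | lra].
  - destruct H2 as [u' [H2 H3]]. exists u'; split; auto. now apply (IH B).
Qed.

(** For steps [0 < t <= 1] a Lipschitz bound is stronger than a Hölder bound, since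
    [t <= Rpower t al]. Limiting the increments in [smooth] to such steps keeps the constant [B]. *)
Lemma smooth0_of_derive al B u u' : al <= 1 ->
  (forall s, Rabs (u s) <= B) -> (forall s, is_derive u s (u' s)) ->
  (forall s, Rabs (u' s) <= B) -> smooth al 0 B u.
Proof.
  intros Hal H0 Hd H1. split; [exact H0|]. intros s t Ht.
  eapply Rle_trans; [apply (Rabs_diff_le_derive u u' B Hd H1)|].
  replace (s + t - s) with t by ring. rewrite Rabs_pos_eq by lra.
  apply Rmult_le_compat_l; [|apply le_Rpower_unit; auto].
  apply Rle_trans with (Rabs (u 0)); [apply Rabs_pos | auto].
Qed.

Lemma smooth_pred al m : al <= 1 -> forall B u, smooth al (S m) B u -> smooth al m B u.
Proof.
  intros Hal. induction m as [|m IH]; intros B u [H1 [u' [H2 H3]]].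
  - apply (smooth0_of_derive al B u u'); auto. exact (smooth_bound _ _ _ _ H3).
  - split; auto. exists u'; split; auto.
Qed.

Lemma smooth_plus al m : forall B1 B2 u v,
  smooth al m B1 u -> smooth al m B2 v -> smooth al m (B1 + B2) (fun s => u s + v s).
Proof.
  induction m as [|m IH]; intros B1 B2 u v [H1 H2] [H3 H4]; simpl;
    (split; [intros s; eapply Rle_trans; [apply Rabs_triang|]; specialize (H1 s); specialize (H3 s); lra|]).
  - intros s t Ht. specialize (H2 s t Ht). specialize (H4 s t Ht).
    replace (u (s + t) + v (s + t) - (u s + v s)) with ((u (s + t) - u s) + (v (s + t) - v s)) by ring.
    eapply Rle_trans; [apply Rabs_triang|]. lra.
  - destruct H2 as [u' [H2 Hu]], H4 as [v' [H4 Hv]].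
    exists (fun s => u' s + v' s); split; [|auto].
    intros s. apply (is_derive_plus u v s (u' s) (v' s)); auto.
Qed.

(** By the Leibniz rule each order splits into two products, which doubles the constant. Each
    product pairs a derivative with an undifferentiated factor, and [smooth_pred] lowers that factor
    to the same order. *)
Lemma smooth_mult al m : al <= 1 -> forall B1 B2 u v,
  smooth al m B1 u -> smooth al m B2 v -> smooth al m (2 ^ S m * B1 * B2) (fun s => u s * v s).
Proof.
  intros Hal. induction m as [|m IH]; intros B1 B2 u v Hu Hv;
    pose proof (smooth_nonneg _ _ _ _ Hu) as P1; pose proof (smooth_nonneg _ _ _ _ Hv) as P2;
    assert (P12 : 0 <= B1 * B2) by now apply Rmult_le_pos.
  - destruct Hu as [H1 H2], Hv as [H3 H4]. split.
    + intros s. rewrite Rabs_mult.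
      assert (Rabs (u s) * Rabs (v s) <= B1 * B2)
        by (apply Rmult_le_compat; auto; apply Rabs_pos). simpl; nra.
    + intros s t Ht. specialize (H2 s t Ht). specialize (H4 s t Ht).
      replace (u (s + t) * v (s + t) - u s * v s)
        with (u (s + t) * (v (s + t) - v s) + (u (s + t) - u s) * v s) by ring.
      eapply Rle_trans; [apply Rabs_triang|]. rewrite !Rabs_mult.
      assert (Rabs (u (s + t)) * Rabs (v (s + t) - v s) <= B1 * (B2 * Rpower t al))
        by (apply Rmult_le_compat; auto; apply Rabs_pos).
      assert (Rabs (u (s + t) - u s) * Rabs (v s) <= (B1 * Rpower t al) * B2)
        by (apply Rmult_le_compat; auto; apply Rabs_pos).
      simpl; lra.
  - pose proof (smooth_pred _ _ Hal _ _ Hu) as Du. pose proof (smooth_pred _ _ Hal _ _ Hv) as Dv.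
    destruct Hu as [H1 [u' [H2 Hu]]], Hv as [H3 [v' [H4 Hv]]]. split.
    + intros s. rewrite Rabs_mult.
      assert (Rabs (u s) * Rabs (v s) <= B1 * B2)
        by (apply Rmult_le_compat; auto; apply Rabs_pos).
      assert (1 <= 2 ^ S (S m)) by (apply pow_R1_Rle; lra). nra.
    + exists (fun s => u' s * v s + u s * v' s). split.
      * intros s. apply (is_derive_mult u v s (u' s) (v' s)); auto. intros; apply Rmult_comm.
      * apply (smooth_weaken al m (2 ^ S m * B1 * B2 + 2 ^ S m * B1 * B2)); [simpl; lra|].
        apply smooth_plus; auto.
Qed.

(** A family closed under differentiation that contains the derivatives of all coordinates of the
    circles below, so the induction in [smooth_trig] runs with one bound for every order. *)
Definition trig (a b s : R) : R := a * cos s + b * sin s.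

Lemma is_derive_trig a b s : is_derive (trig a b) s (trig b (- a) s).
Proof. unfold trig. auto_derive; auto. ring. Qed.

Lemma trig_bound a b s : Rabs a <= 1 -> Rabs b <= 1 -> Rabs (trig a b s) <= 2.
Proof.
  intros Ha Hb. unfold trig. eapply Rle_trans; [apply Rabs_triang|]. rewrite !Rabs_mult.
  assert (Rabs (cos s) <= 1) by (apply Rabs_le; pose proof (COS_bound s); lra).
  assert (Rabs (sin s) <= 1) by (apply Rabs_le; pose proof (SIN_bound s); lra).
  pose proof (Rabs_pos a); pose proof (Rabs_pos b).
  pose proof (Rabs_pos (cos s)); pose proof (Rabs_pos (sin s)). nra.
Qed.

Lemma smooth_trig al m : al <= 1 -> forall a b,
  Rabs a <= 1 -> Rabs b <= 1 -> smooth al m 2 (trig a b).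
Proof.
  intros Hal. induction m as [|m IH]; intros a b Ha Hb.
  - apply (smooth0_of_derive al 2 _ (trig b (- a))); auto; intros s;
      [apply trig_bound | apply is_derive_trig | apply trig_bound]; try rewrite Rabs_Ropp; auto.
  - split; [intros; now apply trig_bound|]. exists (trig b (- a)). split.
    + intros; apply is_derive_trig.
    + apply IH; auto. now rewrite Rabs_Ropp.
Qed.

Definition fd (t : R) (u : R -> R) (s : R) : R := u (s + t) - u s.

Lemma is_derive_iter_fd t n : forall u u', (forall s, is_derive u s (u' s)) ->
  forall s, is_derive (Nat.iter n (fd t) u) s (Nat.iter n (fd t) u' s).
Proof.
  induction n as [|n IH]; intros u u' H s; simpl; auto.
  unfold fd at 1 3. apply (is_derive_minus (fun s => Nat.iter n (fd t) u (s + t)) (Nat.iter n (fd t) u)).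
  - evar_last. apply (is_derive_comp (Nat.iter n (fd t) u) (fun s => s + t)); [apply IH, H|].
    auto_derive; auto. simpl. apply Rmult_1_l.
  - apply IH, H.
Qed.

(** Differences commute with derivation, so the mean value theorem trades one difference of step [t]
    for one derivative and a factor [t]. After [m] trades a single difference remains, and the
    increment condition bounds it. *)
Lemma iter_fd_bound al t m : 0 < t <= 1 -> forall B u, smooth al m B u ->
  forall s, Rabs (Nat.iter (S m) (fd t) u s) <= B * (t ^ m * Rpower t al).
Proof.
  intros Ht. induction m as [|m IH]; intros B u [H1 H2] s.
  - simpl. unfold fd. rewrite Rmult_1_l. apply H2; auto.
  - destruct H2 as [u' [H2 H3]].
    change (Nat.iter (S (S m)) (fd t) u s) with
      (Nat.iter (S m) (fd t) u (s + t) - Nat.iter (S m) (fd t) u s).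
    eapply Rle_trans.
    + apply (Rabs_diff_le_derive _ (Nat.iter (S m) (fd t) u') (B * (t ^ m * Rpower t al))).
      * apply is_derive_iter_fd, H2.
      * apply IH, H3.
    + replace (s + t - s) with t by ring. rewrite Rabs_pos_eq by lra. simpl; lra.
Qed.

(** * Partial derivatives and the chain rule *)

Definition pdr (a : axis) (g : R3 -> R) (x : R3) : R := Derive (fun t => g (shift a t x)) 0.

Definition pdr_ex (a : axis) (g : R3 -> R) (x : R3) : Prop :=
  ex_derive (fun t => g (shift a t x)) 0.

Definition cont_on (U : R3 -> Prop) (g : R3 -> R) : Prop :=
  forall x, U x -> forall eps, 0 < eps -> exists delta, 0 < delta /\
    forall y, U y -> dist3 x y < delta -> Rabs (g y - g x) < eps.

Lemma triple_eq (x1 x2 x3 y1 y2 y3 : R) :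
  x1 = y1 -> x2 = y2 -> x3 = y3 -> (x1, x2, x3) = (y1, y2, y3).
Proof. now intros -> -> ->. Qed.

Lemma shift_shift a u t x : shift a t (shift a u x) = shift a (u + t) x.
Proof. destruct x as [[x1 x2] x3], a; simpl; apply triple_eq; ring. Qed.

Lemma shift_comm a b u v x : shift a u (shift b v x) = shift b v (shift a u x).
Proof. destruct x as [[x1 x2] x3], a, b; simpl; apply triple_eq; ring. Qed.

Lemma shift_0 a x : shift a 0 x = x.
Proof. destruct x as [[x1 x2] x3], a; simpl; apply triple_eq; ring. Qed.

Lemma is_derive_shift a (g : R3 -> R) x u l :
  is_derive (fun t => g (shift a t (shift a u x))) 0 l <->
  is_derive (fun z => g (shift a z x)) u l.
Proof.
  split; intros H.
  - apply (is_derive_ext (fun z => (fun t => g (shift a t (shift a u x))) (z - u))).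
    { intros z. rewrite shift_shift. do 2 f_equal. change (u + (z - u) = z); ring. }
    evar_last.
    + apply (is_derive_comp (fun t => g (shift a t (shift a u x))) (fun z => z - u)).
      * replace (u - u) with 0 by ring. exact H.
      * auto_derive; auto.
    + apply Rmult_1_l.
  - apply (is_derive_ext (fun t => (fun z => g (shift a z x)) (u + t))).
    { intros z. now rewrite shift_shift. }
    evar_last.
    + apply (is_derive_comp (fun z => g (shift a z x)) (fun t => u + t)).
      * rewrite Rplus_0_r. exact H.
      * auto_derive; auto.
    + apply Rmult_1_l.
Qed.

(** Both sides are limits of the same difference quotients, so the identity holds for every [g],
    differentiable or not. *)
Lemma Derive_shift a (g : R3 -> R) x u :
  Derive (fun z => g (shift a z x)) u = pdr a g (shift a u x).
Proof.
  unfold pdr, Derive, Lim. f_equal. apply Lim_seq_ext. intros n.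
  rewrite !shift_shift. do 4 f_equal; [do 2 f_equal; ring | do 2 f_equal; ring].
Qed.

Lemma ex_derive_shift a (g : R3 -> R) x u :
  pdr_ex a g (shift a u x) -> ex_derive (fun z => g (shift a z x)) u.
Proof. intros [l H]. exists l. now apply is_derive_shift. Qed.

Lemma dist3_le x1 x2 x3 y1 y2 y3 :
  dist3 (x1, x2, x3) (y1, y2, y3) <= Rabs (x1 - y1) + Rabs (x2 - y2) + Rabs (x3 - y3).
Proof.
  simpl. pose proof (Rabs_pos (x1 - y1)); pose proof (Rabs_pos (x2 - y2)); pose proof (Rabs_pos (x3 - y3)).
  rewrite <- (sqrt_pow2 (Rabs (x1 - y1) + Rabs (x2 - y2) + Rabs (x3 - y3))) by lra.
  apply sqrt_le_1_alt.
  pose proof (pow2_abs (x1 - y1)); pose proof (pow2_abs (x2 - y2)); pose proof (pow2_abs (x3 - y3)).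
  simpl in *. nra.
Qed.

Lemma dist3_shift2 a b u v x : dist3 x (shift a u (shift b v x)) <= Rabs u + Rabs v.
Proof.
  destruct x as [[x1 x2] x3].
  pose proof (Rabs_triang u v) as T. pose proof (Rabs_triang v u).
  pose proof (Rabs_Ropp u); pose proof (Rabs_Ropp v).
  pose proof (Rabs_pos u); pose proof (Rabs_pos v).
  destruct a, b; simpl shift; eapply Rle_trans; try apply dist3_le;
    repeat match goal with |- context [Rabs (?x - ?y)] =>
      first [ replace (x - y) with 0 by ring | replace (x - y) with (- u) by ring
            | replace (x - y) with (- v) by ring | replace (x - y) with (- (u + v)) by ring ] end;
    rewrite ?Rabs_Ropp, ?Rabs_R0; lra.
Qed.

Lemma open3_shift2 U a b x : open3 U -> U x ->
  exists delta, 0 < delta /\ forall u v, Rabs u < delta -> Rabs v < delta ->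
    U (shift a u (shift b v x)).
Proof.
  intros HU Hx. destruct (HU x Hx) as [e [He H]]. exists (e / 2). split; [lra|].
  intros u v Hu Hv. apply H. pose proof (dist3_shift2 a b u v x). lra.
Qed.

Lemma cont_on_shift2 U g a b x : open3 U -> U x -> cont_on U g ->
  continuity_2d_pt (fun u v => g (shift a u (shift b v x))) 0 0.
Proof.
  intros HU Hx Hg [e He].
  destruct (open3_shift2 U a b x HU Hx) as [d1 [Hd1 H1]].
  destruct (Hg x Hx e He) as [d2 [Hd2 H2]].
  assert (Hd : 0 < Rmin d1 (d2 / 2)) by (apply Rmin_pos; lra).
  exists (mkposreal _ Hd). simpl. intros u v Hu Hv. rewrite Rminus_0_r in *.
  pose proof (Rmin_l d1 (d2 / 2)); pose proof (Rmin_r d1 (d2 / 2)).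
  rewrite !shift_0. apply H2.
  - apply H1; lra.
  - pose proof (dist3_shift2 a b u v x). lra.
Qed.

(** Schwarz's theorem for the function of two real variables obtained by shifting [x] along the axes
    [a] and [b]; the shifts commute, which lets either variable be differentiated first. *)
Lemma pdr_comm U g x : open3 U ->
  (forall a y, U y -> pdr_ex a g y) ->
  (forall a b y, U y -> pdr_ex b (pdr a g) y) ->
  (forall a b, cont_on U (pdr b (pdr a g))) ->
  U x -> forall a b, pdr a (pdr b g) x = pdr b (pdr a g) x.
Proof.
  intros HU H1 H2 H3 Hx a b.
  set (f := fun u v => g (shift a u (shift b v x))).
  assert (Eb : forall z v, Derive (fun t => f z t) v = pdr b g (shift a z (shift b v x))).
  { intros z v. rewrite shift_comm, <- Derive_shift. apply Derive_ext. intros t. unfold f. now rewrite shift_comm. }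
  assert (Ea : forall z v, Derive (fun t => f t v) z = pdr a g (shift a z (shift b v x))).
  { intros z v. unfold f. now rewrite Derive_shift. }
  assert (Eab : forall u v, Derive (fun z => Derive (fun t => f z t) v) u
                            = pdr a (pdr b g) (shift a u (shift b v x))).
  { intros u v. rewrite <- Derive_shift. apply Derive_ext. intros; apply Eb. }
  assert (Eba : forall u v, Derive (fun z => Derive (fun t => f t z) u) v
                            = pdr b (pdr a g) (shift a u (shift b v x))).
  { intros u v. rewrite shift_comm, <- Derive_shift. apply Derive_ext.
    intros z. now rewrite Ea, shift_comm. }
  assert (S : Derive (fun z => Derive (fun t => f z t) 0) 0 = Derive (fun z => Derive (fun t => f t z) 0) 0).
  { apply Schwarz.
    - destruct (open3_shift2 U a b x HU Hx) as [d [Hd Hin]].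
      exists (mkposreal d Hd). simpl. intros u v Hu Hv. rewrite Rminus_0_r in *.
      specialize (Hin u v Hu Hv). repeat split.
      + unfold f. apply (ex_derive_shift a g). auto.
      + apply (ex_derive_ext (fun z => g (shift b z (shift a u x)))).
        { intros; unfold f; now rewrite shift_comm. }
        apply (ex_derive_shift b g). rewrite shift_comm; auto.
      + apply (ex_derive_ext (fun z => pdr b g (shift a z (shift b v x)))).
        { intros; now rewrite Eb. }
        apply (ex_derive_shift a (pdr b g)). auto.
      + apply (ex_derive_ext (fun z => pdr a g (shift b z (shift a u x)))).
        { intros; now rewrite Ea, shift_comm. }
        apply (ex_derive_shift b (pdr a g)). rewrite shift_comm; auto.
    - apply (continuity_2d_pt_ext (fun u v => pdr a (pdr b g) (shift a u (shift b v x)))).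
      { intros; now rewrite Eab. } now apply (cont_on_shift2 U).
    - apply (continuity_2d_pt_ext (fun u v => pdr b (pdr a g) (shift a u (shift b v x)))).
      { intros; now rewrite Eba. } now apply (cont_on_shift2 U). }
  rewrite Eab, Eba, !shift_0 in S. exact S.
Qed.

Lemma increment_axis a (g : R3 -> R) y d c e :
  (forall z, Rabs z <= Rabs d -> pdr_ex a g (shift a z y) /\ Rabs (pdr a g (shift a z y) - c) <= e) ->
  Rabs (g (shift a d y) - g y - c * d) <= e * Rabs d.
Proof.
  intros H.
  assert (Hin : forall z, Rmin 0 d <= z <= Rmax 0 d -> Rabs z <= Rabs d).
  { intros z [Hz1 Hz2]. unfold Rmin, Rmax in *.
    destruct (Rle_dec 0 d); apply Rabs_le; [rewrite Rabs_pos_eq by lra | rewrite Rabs_left by lra]; lra. }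
  assert (D : forall z, Rabs z <= Rabs d ->
     is_derive (fun z => g (shift a z y) - c * z) z (pdr a g (shift a z y) - c)).
  { intros z Hz. apply (is_derive_minus (fun z => g (shift a z y)) (fun z => c * z)).
    - rewrite <- Derive_shift. apply Derive_correct, (ex_derive_shift a g), H, Hz.
    - auto_derive; auto. ring. }
  destruct (MVT_gen (fun z => g (shift a z y) - c * z) 0 d (fun z => pdr a g (shift a z y) - c))
    as [z [Hz E]].
  - intros z Hz. apply D, Hin. lra.
  - intros z Hz. apply continuity_pt_filterlim, (ex_derive_continuous (fun z => g (shift a z y) - c * z)).
    eexists; apply D, Hin, Hz.
  - rewrite shift_0 in E.
    replace (g (shift a d y) - g y - c * d) with (g (shift a d y) - c * d - (g y - c * 0)) by ring.
    rewrite E, Rminus_0_r, Rabs_mult. apply Rmult_le_compat_r; [apply Rabs_pos|].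
    apply H, Hin, Hz.
Qed.

Definition shift3 (d1 d2 d3 : R) (x : R3) : R3 := shift Ax1 d1 (shift Ax2 d2 (shift Ax3 d3 x)).

(** Continuous partial derivatives give total differentiability: the displacement is made along
    [Ax3], [Ax2], [Ax1] in turn, and on each leg the mean value theorem compares the partial
    derivative with its value at [x]. *)
Lemma increment_total U (g : R3 -> R) x e : open3 U -> U x -> 0 < e ->
  (forall a y, U y -> pdr_ex a g y) -> (forall a, cont_on U (pdr a g)) ->
  exists delta, 0 < delta /\ forall d1 d2 d3,
    Rabs d1 < delta -> Rabs d2 < delta -> Rabs d3 < delta ->
    Rabs (g (shift3 d1 d2 d3 x) - g x
          - (pdr Ax1 g x * d1 + pdr Ax2 g x * d2 + pdr Ax3 g x * d3))
      <= e * (Rabs d1 + Rabs d2 + Rabs d3).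
Proof.
  intros HU Hx He H1 H2.
  destruct (HU x Hx) as [d0 [Hd0 K0]].
  destruct (H2 Ax1 x Hx e He) as [e1 [He1 K1]].
  destruct (H2 Ax2 x Hx e He) as [e2 [He2 K2]].
  destruct (H2 Ax3 x Hx e He) as [e3 [He3 K3]].
  set (m := Rmin (Rmin d0 e1) (Rmin e2 e3)).
  assert (Hm : 0 < m) by (unfold m; repeat apply Rmin_pos; auto).
  assert (m <= d0 /\ m <= e1 /\ m <= e2 /\ m <= e3) as (M0 & M1 & M2 & M3).
  { unfold m. repeat split.
    - eapply Rle_trans; [apply Rmin_l | apply Rmin_l].
    - eapply Rle_trans; [apply Rmin_l | apply Rmin_r].
    - eapply Rle_trans; [apply Rmin_r | apply Rmin_l].
    - eapply Rle_trans; [apply Rmin_r | apply Rmin_r]. }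
  assert (Hdist : forall z1 z2 z3, Rabs z1 < m / 3 -> Rabs z2 < m / 3 -> Rabs z3 < m / 3 ->
            dist3 x (shift3 z1 z2 z3 x) < m).
  { intros z1 z2 z3 Z1 Z2 Z3. unfold shift3. destruct x as [[x1 x2] x3]; simpl shift.
    eapply Rle_lt_trans; [apply dist3_le|].
    replace (x1 - (x1 + z1)) with (- z1) by ring.
    replace (x2 - (x2 + z2)) with (- z2) by ring.
    replace (x3 - (x3 + z3)) with (- z3) by ring.
    rewrite !Rabs_Ropp. lra. }
  (* By [dist3_le] the three coordinate moves add up, so each gets a third of the radius. *)
  exists (m / 3). split; [lra|]. intros d1 d2 d3 D1 D2 D3.
  assert (Z : Rabs 0 < m / 3) by (rewrite Rabs_R0; lra).
  assert (I1 : Rabs (g (shift Ax1 d1 (shift Ax2 d2 (shift Ax3 d3 x))) - g (shift Ax2 d2 (shift Ax3 d3 x))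
                     - pdr Ax1 g x * d1) <= e * Rabs d1).
  { apply increment_axis. intros z Hz.
    assert (Hdz : dist3 x (shift3 z d2 d3 x) < m) by (apply Hdist; lra).
    assert (HUz : U (shift3 z d2 d3 x)) by (apply K0; lra).
    split; [now apply H1|]. left. apply K1; auto. unfold shift3 in *; lra. }
  assert (I2 : Rabs (g (shift Ax2 d2 (shift Ax3 d3 x)) - g (shift Ax3 d3 x)
                     - pdr Ax2 g x * d2) <= e * Rabs d2).
  { apply increment_axis. intros z Hz.
    assert (Hdz : dist3 x (shift3 0 z d3 x) < m) by (apply Hdist; lra).
    assert (HUz : U (shift3 0 z d3 x)) by (apply K0; lra).
    unfold shift3 in *. rewrite shift_0 in *.
    split; [now apply H1|]. left. apply K2; auto. lra. }
  assert (I3 : Rabs (g (shift Ax3 d3 x) - g x - pdr Ax3 g x * d3) <= e * Rabs d3).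
  { apply increment_axis. intros z Hz.
    assert (Hdz : dist3 x (shift3 0 0 z x) < m) by (apply Hdist; lra).
    assert (HUz : U (shift3 0 0 z x)) by (apply K0; lra).
    unfold shift3 in *. rewrite !shift_0 in *.
    split; [now apply H1|]. left. apply K3; auto. lra. }
  unfold shift3.
  match goal with |- Rabs ?X <= _ => replace X with
    ((g (shift Ax1 d1 (shift Ax2 d2 (shift Ax3 d3 x))) - g (shift Ax2 d2 (shift Ax3 d3 x)) - pdr Ax1 g x * d1)
     + (g (shift Ax2 d2 (shift Ax3 d3 x)) - g (shift Ax3 d3 x) - pdr Ax2 g x * d2)
     + (g (shift Ax3 d3 x) - g x - pdr Ax3 g x * d3)) by ring end.
  eapply Rle_trans; [apply Rabs_triang|].
  eapply Rle_trans; [apply Rplus_le_compat_r, Rabs_triang|]. lra.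
Qed.

Lemma is_derive_0_of_little_o (r : R -> R) s :
  (forall e, 0 < e -> exists delta, 0 < delta /\
     forall h, Rabs h < delta -> Rabs (r (s + h) - r s) <= e * Rabs h) ->
  is_derive r s 0.
Proof.
  intros H. apply is_derive_Reals. intros e He.
  destruct (H (e / 2)) as [d [Hd K]]; [lra|]. exists (mkposreal d Hd). simpl. intros h Hh Hhd.
  specialize (K h Hhd). unfold Rdiv. rewrite Rminus_0_r, Rabs_mult, Rabs_inv by auto.
  assert (0 < Rabs h) by now apply Rabs_pos_lt.
  apply (Rmult_lt_reg_r (Rabs h)); [auto|].
  rewrite Rmult_assoc, Rinv_l, Rmult_1_r by lra. nra.
Qed.

Lemma is_derive_along U (g : R3 -> R) (c1 c2 c3 c1' c2' c3' : R -> R) :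
  open3 U -> (forall s, U (c1 s, c2 s, c3 s)) ->
  (forall a y, U y -> pdr_ex a g y) -> (forall a, cont_on U (pdr a g)) ->
  (forall s, is_derive c1 s (c1' s)) -> (forall s, is_derive c2 s (c2' s)) ->
  (forall s, is_derive c3 s (c3' s)) ->
  (forall s, Rabs (c1' s) <= 2) -> (forall s, Rabs (c2' s) <= 2) -> (forall s, Rabs (c3' s) <= 2) ->
  forall s, is_derive (fun s => g (c1 s, c2 s, c3 s)) s
    (pdr Ax1 g (c1 s, c2 s, c3 s) * c1' s + pdr Ax2 g (c1 s, c2 s, c3 s) * c2' s
     + pdr Ax3 g (c1 s, c2 s, c3 s) * c3' s).
Proof.
  intros HU Hc H1 H2 D1 D2 D3 B1 B2 B3 s.
  set (x := (c1 s, c2 s, c3 s)).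
  (* The differential of [g] at the base point, evaluated along the curve, carries the whole
     derivative; the remainder is little-o and has derivative zero. *)
  set (L := fun z => pdr Ax1 g x * c1 z + pdr Ax2 g x * c2 z + pdr Ax3 g x * c3 z).
  apply (is_derive_ext (fun z => (g (c1 z, c2 z, c3 z) - L z) + L z)).
  { intros z. simpl. ring. }
  evar_last.
  - apply (is_derive_plus (fun z => g (c1 z, c2 z, c3 z) - L z) L).
    + apply is_derive_0_of_little_o. intros e He.
      (* Each of the three coordinates moves by at most [2 * Rabs h], so the increments sum to at
         most [6 * Rabs h]; the same bound on a single coordinate explains [d / 2] below. *)
      destruct (increment_total U g x (e / 6) HU (Hc s)) as [d [Hd K]]; auto; [lra|].
      exists (d / 2). split; [lra|]. intros h Hh.
      assert (E1 : Rabs (c1 (s + h) - c1 s) <= 2 * Rabs h).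
      { replace h with (s + h - s) at 2 by ring. now apply (Rabs_diff_le_derive c1 c1'). }
      assert (E2 : Rabs (c2 (s + h) - c2 s) <= 2 * Rabs h).
      { replace h with (s + h - s) at 2 by ring. now apply (Rabs_diff_le_derive c2 c2'). }
      assert (E3 : Rabs (c3 (s + h) - c3 s) <= 2 * Rabs h).
      { replace h with (s + h - s) at 2 by ring. now apply (Rabs_diff_le_derive c3 c3'). }
      specialize (K (c1 (s + h) - c1 s) (c2 (s + h) - c2 s) (c3 (s + h) - c3 s)).
      assert (Ex : shift3 (c1 (s + h) - c1 s) (c2 (s + h) - c2 s) (c3 (s + h) - c3 s) x
                   = (c1 (s + h), c2 (s + h), c3 (s + h))).
      { unfold shift3, x; simpl. apply triple_eq; ring. }
      rewrite Ex in K.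
      match goal with |- Rabs ?X <= _ => replace X with
        (g (c1 (s + h), c2 (s + h), c3 (s + h)) - g x -
         (pdr Ax1 g x * (c1 (s + h) - c1 s) + pdr Ax2 g x * (c2 (s + h) - c2 s) + pdr Ax3 g x * (c3 (s + h) - c3 s)))
        by (unfold L; fold x; ring) end.
      eapply Rle_trans; [apply K; lra|]. nra.
    + apply (is_derive_plus (fun z => pdr Ax1 g x * c1 z + pdr Ax2 g x * c2 z) (fun z => pdr Ax3 g x * c3 z)).
      * apply (is_derive_plus (fun z => pdr Ax1 g x * c1 z) (fun z => pdr Ax2 g x * c2 z)).
        -- apply is_derive_scal, D1.
        -- apply is_derive_scal, D2.
      * apply is_derive_scal, D3.
  - unfold plus, zero; simpl. ring.
Qed.

(** * Smoothness along circles on the sphere *)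

(** Derivatives and integrals of complex functions are taken componentwise here; the boolean lets
    one real statement serve both components. *)
Definition part (b : bool) (z : C) : R := if b then Re z else Im z.

Lemma part_le_Cmod b z : Rabs (part b z) <= Cmod z.
Proof.
  pose proof (Rmax_Cmod z).
  destruct b; simpl; (eapply Rle_trans; [|apply H]); [apply Rmax_l | apply Rmax_r].
Qed.

Lemma part_minus b z w : part b (Cminus z w) = part b z - part b w.
Proof. destruct b, z, w; reflexivity. Qed.

Lemma C_eq_part z w : (forall b, part b z = part b w) -> z = w.
Proof.
  intros H. destruct z, w. pose proof (H true); pose proof (H false). simpl in *. congruence.
Qed.

Lemma part_pd b a g x : part b (pd a g x) = pdr a (fun y => part b (g y)) x.
Proof. destruct b; reflexivity. Qed.

Lemma pdr_ext a (g h : R3 -> R) x : (forall y, g y = h y) -> pdr a g x = pdr a h x.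
Proof. intros E. apply Derive_ext. intros; apply E. Qed.

Lemma pdr_ex_part b a g x : pd_exists a g x -> pdr_ex a (fun y => part b (g y)) x.
Proof. intros [H1 H2]. destruct b; assumption. Qed.

Lemma Ck_cont_on U k g l b : Ck U k g -> (length l <= k)%nat ->
  cont_on U (fun y => part b (Dl l g y)).
Proof.
  intros H Hl x Hx e He. destruct (H l Hl) as [[_ Hc] _].
  destruct (Hc e He) as [d [Hd K]]. exists d; split; auto. intros y Hy Hxy.
  rewrite <- part_minus. eapply Rle_lt_trans; [apply part_le_Cmod|].
  replace (Cminus (Dl l g y) (Dl l g x)) with (Copp (Cminus (Dl l g x) (Dl l g y))) by ring.
  rewrite Cmod_opp. auto.
Qed.

Lemma Ck_pdr_ex U k g l b : Ck U k g -> (length l < k)%nat ->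
  forall a y, U y -> pdr_ex a (fun y => part b (Dl l g y)) y.
Proof.
  intros H Hl a y Hy. apply pdr_ex_part. apply (H l); auto. lia.
Qed.

Lemma pdr_ext_ex a (g h : R3 -> R) x : (forall y, g y = h y) -> pdr_ex a g x -> pdr_ex a h x.
Proof. intros E. apply ex_derive_ext. intros; apply E. Qed.

Lemma cont_on_ext U (g h : R3 -> R) : (forall y, g y = h y) -> cont_on U g -> cont_on U h.
Proof. intros E H x Hx e He. destruct (H x Hx e He) as [d [Hd K]]. exists d; split; auto. intros. rewrite <- !E. auto. Qed.

Lemma Dl_swap U k g a b l x : open3 U -> Ck U k g -> (length l + 2 <= k)%nat -> U x ->
  Dl (a :: b :: l) g x = Dl (b :: a :: l) g x.
Proof.
  intros HU H Hl Hx. apply C_eq_part. intros c. simpl. rewrite !part_pd.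
  rewrite (pdr_ext a _ (pdr b (fun y => part c (Dl l g y)))) by (intros; apply part_pd).
  rewrite (pdr_ext b _ (pdr a (fun y => part c (Dl l g y)))) by (intros; apply part_pd).
  apply (pdr_comm U); auto.
  - intros a' y Hy. apply (Ck_pdr_ex U k); auto. lia.
  - intros a' b' y Hy. apply (pdr_ext_ex b' (fun y => part c (Dl (a' :: l) g y))).
    { intros; simpl; apply part_pd. }
    apply (Ck_pdr_ex U k); auto. simpl; lia.
  - intros a' b'. apply (cont_on_ext U (fun y => part c (Dl (b' :: a' :: l) g y))).
    { intros; simpl; rewrite part_pd. apply pdr_ext. intros; apply part_pd. }
    apply (Ck_cont_on U k); auto. simpl; lia.
Qed.

Lemma pd_ext_on U a g h x : open3 U -> U x -> (forall y, U y -> g y = h y) -> pd a g x = pd a h x.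
Proof.
  intros HU Hx E. apply C_eq_part. intros b. rewrite !part_pd. apply Derive_ext_loc.
  destruct (open3_shift2 U a a x HU Hx) as [d [Hd K]]. exists (mkposreal d Hd).
  intros t Ht. rewrite E; auto. rewrite <- (shift_0 a x). apply K; [|rewrite Rabs_R0; auto].
  unfold ball in Ht; simpl in Ht; unfold AbsRing_ball in Ht; simpl in Ht.
  unfold abs, minus, plus, opp in Ht; simpl in Ht. now rewrite Ropp_0, Rplus_0_r in Ht.
Qed.

(** The chain rule yields derivatives along arbitrary lists of axes, while [ext_value] contains only
    the sorted ones. Swaps of neighbours generate all permutations. Under a further derivative the
    two functions are known to agree on [U] only, which suffices because [U] is open. *)
Lemma Dl_perm U k g l l' : open3 U -> Ck U k g -> Permutation l l' -> (length l <= k)%nat ->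
  forall x, U x -> Dl l g x = Dl l' g x.
Proof.
  intros HU H P. induction P as [|a l l' P IH|a b l|l l' l'' P1 IH1 P2 IH2]; intros Hl x Hx; auto.
  - simpl in *. apply (pd_ext_on U); auto. intros; apply IH; auto. lia.
  - apply (Dl_swap U k); auto. simpl in Hl; lia.
  - rewrite IH1 by auto. apply IH2; auto. rewrite <- (Permutation_length P1); auto.
Qed.

Lemma axis_list_sort (l : list axis) : exists b1 b2 b3, (b1 + b2 + b3 = length l)%nat /\
  Permutation l (repeat Ax1 b1 ++ repeat Ax2 b2 ++ repeat Ax3 b3).
Proof.
  induction l as [|a l (b1 & b2 & b3 & E & P)].
  - exists 0%nat, 0%nat, 0%nat. auto.
  - destruct a.
    + exists (S b1), b2, b3. split; [simpl; lia|]. simpl. now constructor.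
    + exists b1, (S b2), b3. split; [simpl; lia|].
      eapply perm_trans; [apply perm_skip, P|]. simpl. apply Permutation_middle.
    + exists b1, b2, (S b3). split; [simpl; lia|].
      eapply perm_trans; [apply perm_skip, P|]. simpl. rewrite !app_assoc. apply Permutation_middle.
Qed.

(** * The value of an extension bounds its derivatives on the sphere *)

Lemma in_Bk b k : (mabs b <= k)%nat -> In b (Bk k).
Proof.
  destruct b as [[b1 b2] b3]. intros H. apply filter_In. split; [|now apply Nat.leb_le].
  simpl in H. apply in_prod; [apply in_prod|]; apply in_seq; lia.
Qed.

(** [supR] sends an infinite least upper bound to [0], so the existence of some [M] is what makes it
    a genuine supremum. *)
Lemma le_supR (P : R -> Prop) M r : (forall x, P x -> x <= M) -> P r -> r <= supR P.
Proof.
  intros H Hr. unfold supR. destruct (Lub_Rbar_correct P) as [H1 H2].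
  specialize (H1 r Hr). specialize (H2 (Finite M)).
  assert (K : Rbar_le (Lub_Rbar P) M) by (apply H2; intros x Hx; simpl; auto).
  destruct (Lub_Rbar P); simpl in *; tauto.
Qed.

(** The condition [0 <= M] covers the empty set, whose [supR] is [0]. *)
Lemma supR_le (P : R -> Prop) M : 0 <= M -> (forall x, P x -> x <= M) -> supR P <= M.
Proof.
  intros H0 H. unfold supR. destruct (Lub_Rbar_correct P) as [H1 H2].
  specialize (H2 (Finite M)).
  assert (K : Rbar_le (Lub_Rbar P) M) by (apply H2; intros x Hx; simpl; auto).
  destruct (Lub_Rbar P); simpl in *; tauto.
Qed.

Lemma sumR_nonneg (l : list R) : (forall x, In x l -> 0 <= x) -> 0 <= sumR l.
Proof.
  induction l as [|a l IH]; simpl; intros H; [lra|].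
  assert (0 <= a) by auto. assert (0 <= sumR l) by auto. lra.
Qed.

Lemma le_sumR (l : list R) x : (forall x, In x l -> 0 <= x) -> In x l -> x <= sumR l.
Proof.
  induction l as [|a l IH]; simpl; intros H [].
  - subst. assert (0 <= sumR l) by (apply sumR_nonneg; auto). lra.
  - assert (0 <= a) by auto. assert (x <= sumR l) by auto. lra.
Qed.

(** Merges the Hölder constants of the finitely many multi-indices into one, so that the Hölder
    supremum in [ext_value] is bounded. *)
Lemma list_uniform_bound (T : Type) (P : T -> R -> Prop) (l : list T) :
  (forall x r r', P x r -> r <= r' -> P x r') -> (forall x, In x l -> exists r, P x r) ->
  exists r, forall x, In x l -> P x r.
Proof.
  intros Hm. induction l as [|a l IH]; intros H.
  - exists 0. intros x [].
  - destruct (H a) as [r1 H1]; [left; auto|]. destruct IH as [r2 H2]; [intros; apply H; right; auto|].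
    exists (Rmax r1 r2). intros x [->|Hx].
    + apply (Hm x r1); auto. apply Rmax_l.
    + apply (Hm x r2); auto. apply Rmax_r.
Qed.

Lemma dist3_pos x y : x <> y -> 0 < dist3 x y.
Proof.
  destruct x as [[x1 x2] x3], y as [[y1 y2] y3]. intros H. simpl. apply sqrt_lt_R0.
  assert (0 <= (x1 - y1) ^ 2) by apply pow2_ge_0.
  assert (0 <= (x2 - y2) ^ 2) by apply pow2_ge_0.
  assert (0 <= (x3 - y3) ^ 2) by apply pow2_ge_0.
  assert (0 <= (x1 - y1) ^ 2 + (x2 - y2) ^ 2 + (x3 - y3) ^ 2) as [|E] by lra; auto.
  exfalso. apply H.
  assert (x1 - y1 = 0) by (apply Rsqr_0_uniq; unfold Rsqr; nra).
  assert (x2 - y2 = 0) by (apply Rsqr_0_uniq; unfold Rsqr; nra).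
  assert (x3 - y3 = 0) by (apply Rsqr_0_uniq; unfold Rsqr; nra).
  apply triple_eq; lra.
Qed.

Lemma north_pole : sphere (0, 0, 1).
Proof. simpl; ring. Qed.

(** The factor [2] in the last bound serves [al = 0], where the increment of a derivative is
    estimated by twice its supremum; for [al > 0] the Hölder term of [ext_value] gives the bound
    directly. *)
Lemma ext_value_bounds U k al fs : open3 U -> (forall x, sphere x -> U x) -> 0 <= al ->
  Ckalpha U k al fs ->
  0 <= ext_value k al fs /\
  (forall l, (length l <= k)%nat -> forall x, sphere x -> Cmod (Dl l fs x) <= ext_value k al fs) /\
  (forall l, length l = k -> forall x y, sphere x -> sphere y -> x <> y ->
     Cmod (Cminus (Dl l fs x) (Dl l fs y)) <= 2 * ext_value k al fs * Rpower (dist3 x y) al).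
Proof.
  intros HU HS Hal [Hk Hh].
  set (F := fun b => supR (fun r => exists xi, sphere xi /\ r = Cmod (Dbeta b fs xi))).
  assert (Dsup : forall b, (mabs b <= k)%nat -> forall x, sphere x -> Cmod (Dbeta b fs x) <= F b).
  { intros [[b1 b2] b3] Hb x Hx.
    destruct (Hk (repeat Ax1 b1 ++ repeat Ax2 b2 ++ repeat Ax3 b3)) as [[[M HM] _] _].
    { rewrite !length_app, !repeat_length. simpl in Hb. lia. }
    apply (le_supR _ M); [|eauto]. intros r [xi [Hxi ->]]. apply HM; auto. }
  assert (F0 : forall x, In x (map F (Bk k)) -> 0 <= x).
  { intros r Hr. apply in_map_iff in Hr. destruct Hr as [b [<- Hb]].
    apply Rle_trans with (Cmod (Dbeta b fs (0, 0, 1))); [apply Cmod_ge_0|].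
    apply Dsup; [|apply north_pole]. apply filter_In in Hb. now apply Nat.leb_le. }
  set (T := if Rlt_dec 0 al then
       supR (fun r => exists b xi eta, In b (Bk k) /\ mabs b = k /\
               sphere xi /\ sphere eta /\ xi <> eta /\
               r = Cmod (Cminus (Dbeta b fs xi) (Dbeta b fs eta)) / Rpower (dist3 xi eta) al)
     else 0).
  assert (E : ext_value k al fs = sumR (map F (Bk k)) + T) by reflexivity.
  assert (HT : 0 < al -> forall b x y, mabs b = k -> sphere x -> sphere y -> x <> y ->
            Cmod (Cminus (Dbeta b fs x) (Dbeta b fs y)) / Rpower (dist3 x y) al <= T).
  { intros Ha b x y Hb Hx Hy Hxy. unfold T. destruct (Rlt_dec 0 al); [|lra].
    destruct (list_uniform_bound mindex (fun b r => mabs b = k -> forall x y, U x -> U y -> x <> y ->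
        Cmod (Cminus (Dbeta b fs x) (Dbeta b fs y)) <= r * Rpower (dist3 x y) al) (Bk k)) as [M HM].
    - intros b' r1 r2 K1 K2 K3 x' y' Hx' Hy' Hxy'. eapply Rle_trans; [apply K1; auto|].
      apply Rmult_le_compat_r; auto. left; apply exp_pos.
    - intros b' Hb'. destruct (Nat.eq_dec (mabs b') k) as [e|ne].
      + destruct (Hh Ha b' Hb' e) as [Cst HC]. exists Cst; auto.
      + exists 0. intros; contradiction.
    - apply (le_supR _ M).
      + intros q (b' & xi & eta & Hb' & e & Hxi & Heta & Hne & ->).
        apply (Rmult_le_reg_r (Rpower (dist3 xi eta) al)); [apply exp_pos|].
        unfold Rdiv. rewrite Rmult_assoc, Rinv_l, Rmult_1_r by (apply Rgt_not_eq, exp_pos).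
        apply HM; auto.
      + exists b, x, y. repeat split; auto. apply in_Bk; lia. }
  assert (T0 : 0 <= T).
  { unfold T. destruct (Rlt_dec 0 al) as [Ha|]; [|lra].
    (* One multi-index of order [k] and two distinct points of the sphere exhibit a nonnegative
       quotient below the supremum. *)
    set (b := (k, 0%nat, 0%nat)).
    apply Rle_trans with (Cmod (Cminus (Dbeta b fs (0,0,1)) (Dbeta b fs (1,0,0))) / Rpower (dist3 (0,0,1) (1,0,0)) al).
    - apply Rmult_le_pos; [apply Cmod_ge_0|]. left. apply Rinv_0_lt_compat, exp_pos.
    - specialize (HT Ha b (0,0,1) (1,0,0)). unfold T in HT. destruct (Rlt_dec 0 al); [|lra].
      apply HT; [unfold b; simpl; lia | simpl; ring | simpl; ring |]. intros e. inversion e. lra. }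
  pose proof (sumR_nonneg _ F0) as S0.
  assert (A : forall l, (length l <= k)%nat -> forall x, sphere x -> Cmod (Dl l fs x) <= ext_value k al fs).
  { intros l Hl x Hx. destruct (axis_list_sort l) as (b1 & b2 & b3 & Eb & P).
    rewrite (Dl_perm U k fs _ _ HU Hk P Hl) by auto.
    apply Rle_trans with (F (b1, b2, b3)); [apply (Dsup (b1, b2, b3)); simpl; auto; lia|].
    apply Rle_trans with (sumR (map F (Bk k))); [|lra].
    apply le_sumR; auto. apply in_map, in_Bk. simpl; lia. }
  split; [lra|]. split; [exact A|].
  intros l Hl x y Hx Hy Hxy. destruct Hal as [Ha|Ha].
  - destruct (axis_list_sort l) as (b1 & b2 & b3 & Eb & P).
    rewrite !(Dl_perm U k fs _ _ HU Hk P) by (auto; lia).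
    assert (Hb : mabs (b1, b2, b3) = k) by (simpl; lia).
    pose proof (HT Ha (b1, b2, b3) x y Hb Hx Hy Hxy) as K. simpl Dbeta in K.
    apply (Rmult_le_compat_r (Rpower (dist3 x y) al)) in K; [|left; apply exp_pos].
    unfold Rdiv in K. rewrite Rmult_assoc, Rinv_l, Rmult_1_r in K by (apply Rgt_not_eq, exp_pos).
    eapply Rle_trans; [apply K|]. apply Rmult_le_compat_r; [left; apply exp_pos | lra].
  - subst al. unfold Rpower. rewrite Rmult_0_l, exp_0.
    eapply Rle_trans; [apply Cmod_triangle|]. rewrite Cmod_opp.
    assert (Hl' : (length l <= k)%nat) by lia.
    pose proof (A l Hl' x Hx). pose proof (A l Hl' y Hy). lra.
Qed.

Record sphere_curve (al : R) (c1 c2 c3 : R -> R) : Prop := {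
  sc_sphere : forall s, sphere (c1 s, c2 s, c3 s);
  sc_derive : exists c1' c2' c3', forall s,
    is_derive c1 s (c1' s) /\ is_derive c2 s (c2' s) /\ is_derive c3 s (c3' s) /\
    forall m, smooth al m 2 c1' /\ smooth al m 2 c2' /\ smooth al m 2 c3' }.

(** At order [0], [12 = 2 * 6]: the [2] of [ext_value_bounds], and [6] because three coordinates
    move with speed at most [2]. Each further order adds the three products of the chain rule, each
    with Leibniz constant [2 ^ S m'] and a coordinate derivative bounded by [2]. *)
Fixpoint chain_const (m : nat) : R :=
  match m with O => 12 | S m' => 3 * (2 ^ S m' * 2) * chain_const m' end.

Lemma chain_const_ge m : 12 <= chain_const m.
Proof.
  induction m as [|m IH]; [simpl; lra|].
  change (12 <= 3 * (2 ^ S m * 2) * chain_const m).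
  assert (1 <= 2 ^ S m) by (apply pow_R1_Rle; lra). nra.
Qed.

(** Induction on [m] for all lists of length [k - m] at once: differentiating one partial derivative
    along the curve gives a combination of partial derivatives of the next order, to which the
    induction hypothesis applies. *)
Lemma smooth_along_curve U k al fs c1 c2 c3 part_b : open3 U -> (forall x, sphere x -> U x) ->
  0 <= al <= 1 -> Ckalpha U k al fs -> sphere_curve al c1 c2 c3 ->
  smooth al k (chain_const k * ext_value k al fs) (fun s => part part_b (fs (c1 s, c2 s, c3 s))).
Proof.
  intros HU HS Hal Hfs [Hc Hd].
  destruct (ext_value_bounds U k al fs HU HS (proj1 Hal) Hfs) as (P & B1 & B2).
  destruct Hfs as [Hk _]. destruct Hd as (c1' & c2' & c3' & Hd).
  set (B := ext_value k al fs) in *.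
  assert (M : forall m l, (length l + m = k)%nat ->
     smooth al m (chain_const m * B) (fun s => part part_b (Dl l fs (c1 s, c2 s, c3 s)))).
  { induction m as [|m IH]; intros l Hl.
    - split.
      + intros s. eapply Rle_trans; [apply part_le_Cmod|]. eapply Rle_trans; [apply B1; auto; lia|].
        simpl; lra.
      + intros s t Ht. rewrite <- part_minus. eapply Rle_trans; [apply part_le_Cmod|].
        assert (Pt : 0 < Rpower t al) by apply exp_pos.
        (* Different parameters may give the same point, as when a circle degenerates at a pole, and
           the Hölder bound is available for distinct points only. *)
        destruct (excluded_middle_informative ((c1 (s + t), c2 (s + t), c3 (s + t)) = (c1 s, c2 s, c3 s))) as [e|ne].
        * rewrite e. unfold Cminus. rewrite Cplus_opp_r, Cmod_0. simpl.
          apply Rmult_le_pos; [|lra]. nra.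
        * eapply Rle_trans; [apply B2; auto; lia|].
          apply Rle_trans with (2 * B * (6 * Rpower t al)); [|simpl; lra].
          apply Rmult_le_compat_l; [lra|].
          apply Rle_trans with (Rpower (6 * t) al).
          -- apply Rle_Rpower_l; [lra|]. split; [now apply dist3_pos|].
             eapply Rle_trans; [apply dist3_le|].
             assert (L : forall c c', (forall s, is_derive c s (c' s)) -> (forall m, smooth al m 2 c') ->
                Rabs (c (s + t) - c s) <= 2 * t).
             { intros c c' D D'. replace t with (Rabs (s + t - s)) at 2
                 by (replace (s + t - s) with t by ring; apply Rabs_pos_eq; lra).
               apply (Rabs_diff_le_derive c c'); auto. exact (smooth_bound _ _ _ _ (D' O)). }
             pose proof (L c1 c1' (fun s => proj1 (Hd s)) (fun m => proj1 (proj2 (proj2 (proj2 (Hd 0))) m))).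
             pose proof (L c2 c2' (fun s => proj1 (proj2 (Hd s))) (fun m => proj1 (proj2 (proj2 (proj2 (proj2 (Hd 0))) m)))).
             pose proof (L c3 c3' (fun s => proj1 (proj2 (proj2 (Hd s)))) (fun m => proj2 (proj2 (proj2 (proj2 (proj2 (Hd 0))) m)))).
             lra.
          -- rewrite <- Rpower_mult_distr by lra. apply Rmult_le_compat_r; [lra|].
             rewrite <- (Rpower_1 6) at 2 by lra. apply Rle_Rpower; lra.
    - split.
      + intros s. eapply Rle_trans; [apply part_le_Cmod|]. eapply Rle_trans; [apply B1; auto; lia|].
        pose proof (chain_const_ge (S m)). nra.
      + exists (fun s => part part_b (Dl (Ax1 :: l) fs (c1 s, c2 s, c3 s)) * c1' s
                       + part part_b (Dl (Ax2 :: l) fs (c1 s, c2 s, c3 s)) * c2' s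
                       + part part_b (Dl (Ax3 :: l) fs (c1 s, c2 s, c3 s)) * c3' s).
        split.
        * intros s. simpl Dl. rewrite !part_pd.
          apply (is_derive_along U (fun y => part part_b (Dl l fs y))); auto; try (intros; apply Hd);
            try (eapply (smooth_bound al 0); apply (Hd 0)).
          -- apply (Ck_pdr_ex U k); auto. lia.
          -- intros a. apply (cont_on_ext U (fun y => part part_b (Dl (a :: l) fs y))).
             { intros; apply part_pd. }
             apply (Ck_cont_on U k); auto. simpl; lia.
        * set (Q := 2 ^ S m * (chain_const m * B) * 2).
          apply (smooth_weaken al m (Q + Q + Q)); [unfold Q; simpl; lra|].
          assert (IH' : forall a, smooth al m (chain_const m * B) (fun s => part part_b (Dl (a :: l) fs (c1 s, c2 s, c3 s)))).
          { intros a. apply IH. simpl; lia. }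
          apply smooth_plus; [apply smooth_plus|]; apply smooth_mult; try lra; try apply IH'; apply (Hd 0). }
  apply (M k nil). reflexivity.
Qed.

Lemma sphere_phi l th : sphere (phi (l, th)).
Proof.
  simpl. pose proof (sin2_cos2 l) as E1. pose proof (sin2_cos2 th) as E2. unfold Rsqr in *.
  replace ((cos l * sin th) * ((cos l * sin th) * 1) + (sin l * sin th) * ((sin l * sin th) * 1)
           + cos th * (cos th * 1))
    with ((sin l * sin l + cos l * cos l) * (sin th * sin th) + cos th * cos th) by ring.
  rewrite E1. lra.
Qed.

Lemma Rabs_sin_le1 x : Rabs (sin x) <= 1.
Proof. apply Rabs_le. pose proof (SIN_bound x). lra. Qed.

Lemma Rabs_cos_le1 x : Rabs (cos x) <= 1.
Proof. apply Rabs_le. pose proof (COS_bound x). lra. Qed.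

Lemma longitude_curve al th : al <= 1 ->
  sphere_curve al (fun l => cos l * sin th) (fun l => sin l * sin th) (fun _ => cos th).
Proof.
  intros Hal. split; [intros l; apply (sphere_phi l th)|].
  exists (trig 0 (- sin th)), (trig (sin th) 0), (trig 0 0).
  assert (Rabs 0 <= 1) by (rewrite Rabs_R0; lra). pose proof (Rabs_sin_le1 th).
  intros s. unfold trig at 1 2 3. split; [|split; [|split]]; try (auto_derive; auto; ring).
  intros m; repeat split; apply smooth_trig; try rewrite Rabs_Ropp; auto.
Qed.

Lemma latitude_curve al l : al <= 1 ->
  sphere_curve al (fun th => cos l * sin th) (fun th => sin l * sin th) cos.
Proof.
  intros Hal. split; [intros th; apply (sphere_phi l th)|].
  exists (trig (cos l) 0), (trig (sin l) 0), (trig 0 (-1)).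
  assert (Rabs 0 <= 1) by (rewrite Rabs_R0; lra).
  assert (Rabs (-1) <= 1) by (apply Rabs_le; lra).
  pose proof (Rabs_sin_le1 l). pose proof (Rabs_cos_le1 l).
  intros s. unfold trig at 1 2 3. split; [|split; [|split]]; try (auto_derive; auto; ring).
  intros m; repeat split; apply smooth_trig; auto.
Qed.

(** * Fourier coefficients and Bessel's inequality *)

Lemma continuous_ex_RInt (u : R -> R) a b : (forall x, continuous u x) -> ex_RInt u a b.
Proof. intros H. apply (ex_RInt_continuous (V := R_CompleteNormedModule)). intros; apply H. Qed.

Lemma RInt_shift (u : R -> R) t a b : (forall x, continuous u x) ->
  RInt (fun x => u (x + t)) a b = RInt u (a + t) (b + t).
Proof.
  intros H. replace (a + t) with (1 * a + t) by ring. replace (b + t) with (1 * b + t) by ring.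
  rewrite <- (RInt_comp_lin u 1 t a b) by now apply continuous_ex_RInt.
  apply RInt_ext. intros x _. unfold scal; simpl; unfold mult; simpl. rewrite Rmult_1_l. f_equal. ring.
Qed.

Lemma RInt_periodic (u : R -> R) a : (forall x, continuous u x) ->
  (forall x, u (x + 2 * PI) = u x) -> RInt u a (a + 2 * PI) = RInt u 0 (2 * PI).
Proof.
  intros H P.
  rewrite <- (RInt_Chasles u a 0 (a + 2 * PI)) by now apply continuous_ex_RInt.
  rewrite <- (RInt_Chasles u 0 (2 * PI) (a + 2 * PI)) by now apply continuous_ex_RInt.
  replace (RInt u (2 * PI) (a + 2 * PI)) with (RInt u 0 a).
  - rewrite <- (opp_RInt_swap u 0 a) by now apply continuous_ex_RInt.
    unfold plus, opp; simpl. ring.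
  - rewrite <- (Rplus_0_l (2 * PI)) at 1. rewrite <- RInt_shift by auto. apply RInt_ext. intros; now rewrite P.
Qed.

Lemma RInt_periodic_shift (u : R -> R) t : (forall x, continuous u x) ->
  (forall x, u (x + 2 * PI) = u x) -> RInt (fun x => u (x + t)) 0 (2 * PI) = RInt u 0 (2 * PI).
Proof.
  intros H P. rewrite RInt_shift by auto. rewrite Rplus_0_l, (Rplus_comm (2 * PI)).
  now apply RInt_periodic.
Qed.

Lemma RInt_periodic_opp (u : R -> R) : (forall x, continuous u x) ->
  (forall x, u (x + 2 * PI) = u x) -> RInt (fun x => u (- x)) 0 (2 * PI) = RInt u 0 (2 * PI).
Proof.
  intros H P. rewrite <- (RInt_periodic u (- (2 * PI))) by auto.
  replace (- (2 * PI) + 2 * PI) with 0 by ring.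
  rewrite <- (opp_RInt_swap u 0 (- (2 * PI))) by now apply continuous_ex_RInt.
  transitivity (opp (RInt (fun y => scal (-1) (u (-1 * y + 0))) 0 (2 * PI))).
  - rewrite <- RInt_opp.
    + apply RInt_ext. intros x _. unfold opp, scal; simpl; unfold mult; simpl.
      replace (-1 * x + 0) with (- x) by ring. ring.
    + apply continuous_ex_RInt. intros x. apply (continuous_scal_r (-1) (fun y => u (-1 * y + 0))).
      apply (continuous_comp (fun y => -1 * y + 0) u); [|apply H].
      apply (ex_derive_continuous (fun y => -1 * y + 0)). auto_derive; auto.
  - pose proof (RInt_comp_lin (V := R_CompleteNormedModule) u (-1) 0 0 (2 * PI)) as E.
    replace (-1 * 0 + 0) with 0 in E by ring. replace (-1 * (2 * PI) + 0) with (- (2 * PI)) in E by ring.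
    f_equal. apply E. now apply continuous_ex_RInt.
Qed.

Definition ccont (u : R -> C) : Prop := forall b x, continuous (fun t => part b (u t)) x.

Lemma ccont_ext u v : (forall t, u t = v t) -> ccont u -> ccont v.
Proof.
  intros E H b x. apply (continuous_ext (fun t => part b (u t))); auto. intros; now rewrite E.
Qed.

Lemma ccont_const c : ccont (fun _ => c).
Proof. intros b x. apply continuous_const. Qed.

Lemma ccont_plus u v : ccont u -> ccont v -> ccont (fun t => Cplus (u t) (v t)).
Proof.
  intros Hu Hv b x. apply (continuous_ext (fun t => part b (u t) + part b (v t))).
  { intros t. destruct b; reflexivity. }
  apply (continuous_plus (V := R_NormedModule) (fun t => part b (u t))); auto.
Qed.

Lemma ccont_minus u v : ccont u -> ccont v -> ccont (fun t => Cminus (u t) (v t)).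
Proof.
  intros Hu Hv b x. apply (continuous_ext (fun t => part b (u t) - part b (v t))).
  { intros t. now rewrite part_minus. }
  apply (continuous_minus (V := R_NormedModule) (fun t => part b (u t))); auto.
Qed.

Lemma ccont_mult u v : ccont u -> ccont v -> ccont (fun t => Cmult (u t) (v t)).
Proof.
  intros Hu Hv b x.
  pose proof (Hu true x); pose proof (Hu false x); pose proof (Hv true x); pose proof (Hv false x).
  destruct b.
  - apply (continuous_ext (fun t => part true (u t) * part true (v t) - part false (u t) * part false (v t))).
    { intros t. reflexivity. }
    apply (continuous_minus (V := R_NormedModule) (fun t => part true (u t) * part true (v t)));
      apply (continuous_mult (K := R_AbsRing)); auto.
  - apply (continuous_ext (fun t => part true (u t) * part false (v t) + part false (u t) * part true (v t))).
    { intros t. reflexivity. }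
    apply (continuous_plus (V := R_NormedModule) (fun t => part true (u t) * part false (v t)));
      apply (continuous_mult (K := R_AbsRing)); auto.
Qed.

Lemma ccont_comp_affine u a b : ccont u -> ccont (fun t => u (a * t + b)).
Proof.
  intros H c x. apply (continuous_comp (fun t => a * t + b) (fun t => part c (u t))); [|apply H].
  apply (ex_derive_continuous (fun t => a * t + b)). auto_derive; auto.
Qed.

Lemma ccont_cexpi : ccont cexpi.
Proof.
  intros b x. destruct b; simpl; [apply (ex_derive_continuous cos) | apply (ex_derive_continuous sin)];
    auto_derive; auto.
Qed.

Lemma ccont_lipschitz u L : (forall x y, Cmod (Cminus (u x) (u y)) <= L * Rabs (x - y)) -> ccont u.
Proof.
  intros H b x. apply continuity_pt_filterlim. intros e He.
  assert (0 <= L).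
  { specialize (H 1 0). rewrite Rminus_0_r, Rabs_R1 in H.
    pose proof (Cmod_ge_0 (Cminus (u 1) (u 0))). lra. }
  (* The [+ 1] keeps the denominator positive when [L = 0]. *)
  exists (e / (L + 1)). split; [apply Rdiv_lt_0_compat; lra|].
  intros y [_ Hy]. simpl in *. unfold R_dist in *. rewrite <- part_minus.
  eapply Rle_lt_trans; [apply part_le_Cmod|]. eapply Rle_lt_trans; [apply H|].
  apply Rle_lt_trans with ((L + 1) * Rabs (y - x)).
  - pose proof (Rabs_pos (y - x)). nra.
  - apply (Rmult_lt_compat_l (L + 1)) in Hy; [|lra].
    replace ((L + 1) * (e / (L + 1))) with e in Hy by (field; lra). exact Hy.
Qed.

Lemma part_CRInt b u x y : part b (CRInt u x y) = RInt (fun t => part b (u t)) x y.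
Proof. destruct b; reflexivity. Qed.

Lemma CRInt_ext u v a b : (forall t, u t = v t) -> CRInt u a b = CRInt v a b.
Proof.
  intros E. apply C_eq_part. intros c. rewrite !part_CRInt. apply RInt_ext. intros; now rewrite E.
Qed.

Lemma CRInt_plus u v a b : ccont u -> ccont v ->
  CRInt (fun t => Cplus (u t) (v t)) a b = Cplus (CRInt u a b) (CRInt v a b).
Proof.
  intros Hu Hv. apply C_eq_part. intros c.
  transitivity (part c (CRInt u a b) + part c (CRInt v a b)); [|destruct c; reflexivity].
  rewrite !part_CRInt.
  rewrite <- (RInt_plus (V := R_CompleteNormedModule)) by (apply continuous_ex_RInt; auto).
  apply RInt_ext. intros t _. destruct c; reflexivity.
Qed.

Lemma RInt_lin2 (u v : R -> R) p q a b : (forall x, continuous u x) -> (forall x, continuous v x) ->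
  RInt (fun t => p * u t + q * v t) a b = p * RInt u a b + q * RInt v a b.
Proof.
  intros Hu Hv.
  rewrite <- (RInt_scal (V := R_CompleteNormedModule) u) by now apply continuous_ex_RInt.
  rewrite <- (RInt_scal (V := R_CompleteNormedModule) v) by now apply continuous_ex_RInt.
  apply (RInt_plus (V := R_CompleteNormedModule) (fun t => scal p (u t)) (fun t => scal q (v t)));
    apply (ex_RInt_scal (V := R_NormedModule)); now apply continuous_ex_RInt.
Qed.

Lemma CRInt_mult_l c u a b : ccont u ->
  CRInt (fun t => Cmult c (u t)) a b = Cmult c (CRInt u a b).
Proof.
  intros Hu. apply C_eq_part. intros d. rewrite part_CRInt. destruct c as [c1 c2].
  destruct d.
  - transitivity (c1 * part true (CRInt u a b) + (- c2) * part false (CRInt u a b)).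
    + rewrite !part_CRInt, <- RInt_lin2 by apply Hu. apply RInt_ext. intros t _. destruct (u t) as [u1 u2]. simpl. ring.
    + destruct (CRInt u a b) as [u1 u2]. simpl. ring.
  - transitivity (c1 * part false (CRInt u a b) + c2 * part true (CRInt u a b)).
    + rewrite !part_CRInt, <- RInt_lin2 by apply Hu. apply RInt_ext. intros t _. destruct (u t) as [u1 u2]. simpl. ring.
    + destruct (CRInt u a b) as [u1 u2]. simpl. ring.
Qed.

(** The same fold as in [S_Omega], so that [K_h] is an [lsum] by conversion. *)
Definition lsum {T : Type} (F : T -> C) (l : list T) : C := fold_right Cplus (RtoC 0) (map F l).

Lemma ccont_lsum (T : Type) (F : T -> R -> C) l : (forall i, ccont (F i)) ->
  ccont (fun t => lsum (fun i => F i t) l).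
Proof.
  intros H. induction l as [|i l IH]; [apply (ccont_const (RtoC 0))|].
  apply (ccont_plus (F i) (fun t => lsum (fun i => F i t) l)); auto.
Qed.

Definition normsq (z : C) : R := Re z * Re z + Im z * Im z.

Lemma normsq_Cmod z : normsq z = Cmod z * Cmod z.
Proof.
  unfold Cmod. rewrite sqrt_def; [unfold normsq, Re, Im; ring|].
  pose proof (pow2_ge_0 (fst z)); pose proof (pow2_ge_0 (snd z)); lra.
Qed.

Lemma normsq_nonneg z : 0 <= normsq z.
Proof. unfold normsq. nra. Qed.

Lemma normsq_mult z w : normsq (Cmult z w) = normsq z * normsq w.
Proof. destruct z, w. unfold normsq; simpl. ring. Qed.

Lemma Cmod_le_parts z : Cmod z <= Rabs (Re z) + Rabs (Im z).
Proof.
  pose proof (Rabs_pos (Re z)); pose proof (Rabs_pos (Im z)).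
  unfold Cmod. rewrite <- (sqrt_pow2 (Rabs (Re z) + Rabs (Im z))) by lra.
  apply sqrt_le_1_alt. fold (Re z); fold (Im z).
  rewrite <- (pow2_abs (Re z)), <- (pow2_abs (Im z)). simpl. nra.
Qed.

Lemma normsq_cexpi t : normsq (cexpi t) = 1.
Proof. unfold normsq, cexpi; simpl. pose proof (sin2_cos2 t). unfold Rsqr in *. lra. Qed.

Lemma Cmod_cexpi t : Cmod (cexpi t) = 1.
Proof.
  pose proof (normsq_cexpi t) as H. rewrite normsq_Cmod in H.
  pose proof (Cmod_ge_0 (cexpi t)). nra.
Qed.

Lemma cexpi_plus s t : cexpi (s + t) = Cmult (cexpi s) (cexpi t).
Proof.
  unfold cexpi, Cmult; simpl. rewrite cos_plus, sin_plus. f_equal; ring.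
Qed.

Lemma cexpi_0 : cexpi 0 = RtoC 1.
Proof. unfold cexpi. now rewrite cos_0, sin_0. Qed.

Lemma cexpi_2PI_nat n : cexpi (INR n * (2 * PI)) = RtoC 1.
Proof.
  induction n as [|n IH]; [simpl; rewrite Rmult_0_l; apply cexpi_0|].
  rewrite S_INR, Rmult_plus_distr_r, cexpi_plus, IH, Rmult_1_l.
  unfold cexpi. rewrite cos_2PI, sin_2PI. apply Cmult_1_l.
Qed.

Lemma cexpi_opp_mult t : Cmult (cexpi (- t)) (cexpi t) = RtoC 1.
Proof. rewrite <- cexpi_plus. replace (- t + t) with 0 by ring. apply cexpi_0. Qed.

Lemma cexpi_2PI_Z (m : Z) : cexpi (IZR m * (2 * PI)) = RtoC 1.
Proof.
  destruct (Z_le_gt_dec 0 m) as [H|H].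
  - rewrite <- (Z2Nat.id m) by auto. rewrite <- INR_IZR_INZ. apply cexpi_2PI_nat.
  - replace (IZR m * (2 * PI)) with (- (INR (Z.to_nat (- m)) * (2 * PI))).
    + rewrite <- (cexpi_opp_mult (INR (Z.to_nat (- m)) * (2 * PI))), cexpi_2PI_nat. symmetry; apply Cmult_1_r.
    + rewrite INR_IZR_INZ, Z2Nat.id, opp_IZR by lia. ring.
Qed.

Lemma cexpi_periodic (m : Z) x : cexpi (IZR m * (x + 2 * PI)) = cexpi (IZR m * x).
Proof. rewrite Rmult_plus_distr_l, cexpi_plus, cexpi_2PI_Z. apply Cmult_1_r. Qed.

Lemma cexpi_PI_Z (m : Z) : cexpi (IZR m * PI) = RtoC (powerRZ (-1) m).
Proof.
  assert (N : forall n, cexpi (INR n * PI) = RtoC ((-1) ^ n)).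
  { induction n as [|n IH]; [simpl; rewrite Rmult_0_l; apply cexpi_0|].
    rewrite S_INR, Rmult_plus_distr_r, cexpi_plus, IH, Rmult_1_l.
    unfold cexpi. rewrite cos_PI, sin_PI. simpl pow. rewrite RtoC_mult. apply Cmult_comm. }
  destruct m as [|p|p].
  - simpl. rewrite Rmult_0_l. apply cexpi_0.
  - simpl. rewrite <- N, INR_IPR. reflexivity.
  - simpl powerRZ. assert (E : / (-1) ^ Pos.to_nat p = (-1) ^ Pos.to_nat p).
    { rewrite <- pow_inv. f_equal. field. }
    rewrite E, <- N. rewrite INR_IPR.
    change (IZR (Z.neg p)) with (- IPR p).
    (* Adding [p] full turns changes the angle [- p PI] into [p PI]. *)
    rewrite <- (Cmult_1_r (cexpi (- IPR p * PI))).
    rewrite <- (cexpi_2PI_nat (Pos.to_nat p)), <- cexpi_plus. f_equal. rewrite INR_IPR. ring.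
Qed.

Definition fc (m : Z) (u : R -> C) : C :=
  Cmult (RtoC (/ (2 * PI))) (CRInt (fun t => Cmult (u t) (cexpi (- (IZR m * t)))) 0 (2 * PI)).

Lemma two_PI_pos : 0 < 2 * PI.
Proof. pose proof PI_RGT_0. lra. Qed.

Lemma ccont_cexpi_lin a : ccont (fun t => cexpi (a * t)).
Proof.
  apply (ccont_ext (fun t => cexpi (a * t + 0))); [intros; f_equal; ring|].
  apply ccont_comp_affine, ccont_cexpi.
Qed.

Lemma ccont_fc_integrand (m : Z) u : ccont u -> ccont (fun t => Cmult (u t) (cexpi (- (IZR m * t)))).
Proof.
  intros H. apply ccont_mult; auto.
  apply (ccont_ext (fun t => cexpi ((- IZR m) * t))); [intros; f_equal; ring|]. apply ccont_cexpi_lin.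
Qed.

Lemma fc_ext m u v : (forall t, u t = v t) -> fc m u = fc m v.
Proof. intros E. unfold fc. f_equal. apply CRInt_ext. intros; now rewrite E. Qed.

Lemma fc_plus m u v : ccont u -> ccont v ->
  fc m (fun t => Cplus (u t) (v t)) = Cplus (fc m u) (fc m v).
Proof.
  intros Hu Hv. unfold fc. rewrite <- Cmult_plus_distr_l. f_equal.
  rewrite <- CRInt_plus by now apply ccont_fc_integrand. apply CRInt_ext. intros; ring.
Qed.

Lemma fc_mult_l m c u : ccont u -> fc m (fun t => Cmult c (u t)) = Cmult c (fc m u).
Proof.
  intros Hu. unfold fc.
  rewrite (CRInt_ext _ (fun t => Cmult c (Cmult (u t) (cexpi (- (IZR m * t)))))) by (intros; ring).
  rewrite CRInt_mult_l by now apply ccont_fc_integrand. ring.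
Qed.

Lemma fc_minus m u v : ccont u -> ccont v ->
  fc m (fun t => Cminus (u t) (v t)) = Cminus (fc m u) (fc m v).
Proof.
  intros Hu Hv.
  rewrite (fc_ext m _ (fun t => Cplus (u t) (Cmult (Copp (RtoC 1)) (v t)))).
  - rewrite fc_plus, fc_mult_l; auto; [|apply ccont_mult; auto; apply ccont_const].
    ring.
  - intros t. ring.
Qed.

Lemma fc_lsum (T : Type) m (F : T -> R -> C) l : (forall i, ccont (F i)) ->
  fc m (fun t => lsum (fun i => F i t) l) = lsum (fun i => fc m (F i)) l.
Proof.
  intros H. induction l as [|i l IH].
  - unfold lsum; simpl. rewrite (fc_ext m _ (fun t => Cmult (RtoC 0) (RtoC 0))) by (intros; ring).
    rewrite (fc_mult_l m (RtoC 0) (fun _ => RtoC 0)) by apply ccont_const. ring.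
  - change (fc m (fun t => Cplus (F i t) (lsum (fun i => F i t) l)) = Cplus (fc m (F i)) (lsum (fun i => fc m (F i)) l)).
    rewrite fc_plus, IH; auto. now apply ccont_lsum.
Qed.

Definition cper (u : R -> C) : Prop := forall t, u (t + 2 * PI) = u t.

Lemma CRInt_periodic_shift u t : ccont u -> cper u ->
  CRInt (fun x => u (x + t)) 0 (2 * PI) = CRInt u 0 (2 * PI).
Proof.
  intros H P. apply C_eq_part. intros b. rewrite !part_CRInt.
  apply (RInt_periodic_shift (fun x => part b (u x))); [apply H|]. intros; now rewrite P.
Qed.

Lemma cper_fc_integrand (m : Z) u : cper u -> cper (fun t => Cmult (u t) (cexpi (- (IZR m * t)))).
Proof.
  intros H t. rewrite H. f_equal. rewrite !Ropp_mult_distr_l, <- !opp_IZR. apply cexpi_periodic.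
Qed.

Lemma fc_shift m u t : ccont u -> cper u ->
  fc m (fun x => u (x + t)) = Cmult (cexpi (IZR m * t)) (fc m u).
Proof.
  intros H P. unfold fc.
  rewrite <- (CRInt_periodic_shift _ t (ccont_fc_integrand m u H) (cper_fc_integrand m u P)).
  rewrite Cmult_assoc, (Cmult_comm (cexpi (IZR m * t))), <- Cmult_assoc. f_equal.
  rewrite <- CRInt_mult_l.
  - apply CRInt_ext. intros x.
    replace (- (IZR m * x)) with (IZR m * t + - (IZR m * (x + t))) by ring. rewrite cexpi_plus. ring.
  - apply (ccont_ext (fun x => (fun y => Cmult (u y) (cexpi (- (IZR m * y)))) (1 * x + t))).
    { intros x. now rewrite Rmult_1_l. }
    apply (ccont_comp_affine (fun y => Cmult (u y) (cexpi (- (IZR m * y))))), ccont_fc_integrand, H.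
Qed.

Lemma fc_reflect m u : ccont u -> cper u -> fc m (fun x => u (- x)) = fc (- m) u.
Proof.
  intros H P. unfold fc. f_equal. apply C_eq_part. intros b. rewrite !part_CRInt.
  rewrite <- (RInt_periodic_opp (fun x => part b (Cmult (u x) (cexpi (- (IZR (- m) * x)))))).
  - apply RInt_ext. intros x _. do 3 f_equal. rewrite opp_IZR. ring.
  - apply (ccont_fc_integrand (- m) u H).
  - intros x. f_equal. apply (cper_fc_integrand (- m) u P).
Qed.

(** The two components are bounded separately, at the cost of the factor [2] that reappears in
    [Cmod_fc_le] and [sigma_majorant]. *)
Lemma Cmod_CRInt_le u (M : R -> R) a b : a <= b -> ccont u -> (forall x, continuous M x) ->
  (forall t, a <= t <= b -> Cmod (u t) <= M t) -> Cmod (CRInt u a b) <= 2 * RInt M a b.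
Proof.
  intros Hab Hu HM H.
  assert (K : forall c, Rabs (part c (CRInt u a b)) <= RInt M a b).
  { intros c. rewrite part_CRInt. apply Rabs_le.
    assert (K : forall t, a <= t <= b -> - M t <= part c (u t) <= M t).
    { intros t Ht. apply Rabs_le_between. eapply Rle_trans; [apply part_le_Cmod | auto]. }
    split.
    - rewrite <- (RInt_opp (V := R_CompleteNormedModule)) by now apply continuous_ex_RInt.
      apply RInt_le; auto; try (apply continuous_ex_RInt; auto).
      + intros x. apply (continuous_opp (V := R_NormedModule)), HM.
      + intros t Ht. apply K; lra.
    - apply RInt_le; auto; try (apply continuous_ex_RInt; auto). intros t Ht. apply K; lra. }
  eapply Rle_trans; [apply Cmod_le_parts|]. pose proof (K true); pose proof (K false). simpl in *. lra.
Qed.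

Lemma RInt_cst c a b : RInt (fun _ => c) a b = (b - a) * c.
Proof. rewrite RInt_const. reflexivity. Qed.

Lemma Cmod_fc_le m u M : ccont u -> (forall t, Cmod (u t) <= M) -> Cmod (fc m u) <= 2 * M.
Proof.
  intros Hu H. unfold fc. pose proof two_PI_pos as HP.
  rewrite Cmod_mult, Cmod_R, Rabs_pos_eq by (left; now apply Rinv_0_lt_compat).
  assert (K : Cmod (CRInt (fun t => Cmult (u t) (cexpi (- (IZR m * t)))) 0 (2 * PI)) <= 2 * RInt (fun _ => M) 0 (2 * PI)).
  { apply Cmod_CRInt_le; [lra | now apply ccont_fc_integrand | intros; apply continuous_const |].
    intros t _. rewrite Cmod_mult, Cmod_cexpi, Rmult_1_r. apply H. }
  rewrite RInt_cst in K.
  apply (Rmult_le_compat_l (/ (2 * PI))) in K; [|left; now apply Rinv_0_lt_compat].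
  eapply Rle_trans; [apply K|]. right. field. apply PI_neq0.
Qed.

Lemma CRInt_cexpi_nonzero (m : Z) : m <> 0%Z -> CRInt (fun t => cexpi (IZR m * t)) 0 (2 * PI) = RtoC 0.
Proof.
  intros Hm. assert (HR : IZR m <> 0) by now apply not_0_IZR.
  pose proof (cexpi_2PI_Z m) as E. unfold cexpi in E. injection E as E1 E2.
  assert (A : forall (F f : R -> R), (forall x, is_derive F x (f x)) -> (forall x, continuous f x) ->
     RInt f 0 (2 * PI) = F (2 * PI) - F 0).
  { intros F f HF Hf. apply is_RInt_unique.
    apply (is_RInt_derive (V := R_CompleteNormedModule) F f); intros; auto. }
  apply C_eq_part. intros b. rewrite part_CRInt. destruct b; simpl.
  - rewrite (A (fun t => sin (IZR m * t) / IZR m)).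
    + rewrite E2, Rmult_0_r, sin_0. field; auto.
    + intros x. auto_derive; auto. field; auto.
    + intros x. apply (ccont_cexpi_lin (IZR m) true x).
  - rewrite (A (fun t => - cos (IZR m * t) / IZR m)).
    + rewrite E1, Rmult_0_r, cos_0. field; auto.
    + intros x. auto_derive; auto. field; auto.
    + intros x. apply (ccont_cexpi_lin (IZR m) false x).
Qed.

Lemma CRInt_const c a b : CRInt (fun _ => c) a b = Cmult (RtoC (b - a)) c.
Proof. unfold CRInt. rewrite !RInt_cst. destruct c. unfold Cmult; simpl. f_equal; ring. Qed.

Lemma fc_cexpi (m n : Z) : fc m (fun t => cexpi (IZR n * t)) = RtoC (if Z.eq_dec n m then 1 else 0).
Proof.
  unfold fc. pose proof two_PI_pos.
  rewrite (CRInt_ext _ (fun t => cexpi (IZR (n - m) * t))).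
  2:{ intros t. rewrite <- cexpi_plus, minus_IZR. f_equal. ring. }
  destruct (Z.eq_dec n m) as [->|Hne].
  - rewrite (CRInt_ext _ (fun _ => RtoC 1)).
    + rewrite CRInt_const, Rminus_0_r, Cmult_1_r, <- RtoC_mult. f_equal. field. apply PI_neq0.
    + intros t. rewrite Z.sub_diag, Rmult_0_l. apply cexpi_0.
  - rewrite CRInt_cexpi_nonzero by lia. ring.
Qed.

Lemma continuous_normsq u : ccont u -> forall x, continuous (fun t => normsq (u t)) x.
Proof.
  intros H x. unfold normsq.
  apply (continuous_plus (V := R_NormedModule) (fun t => Re (u t) * Re (u t)));
    apply (continuous_mult (K := R_AbsRing)); first [apply (H true x) | apply (H false x)].
Qed.

Definition energy (u : R -> C) : R := RInt (fun t => normsq (u t)) 0 (2 * PI).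

Definition strip (m : Z) (u : R -> C) (t : R) : C :=
  Cminus (u t) (Cmult (fc m u) (cexpi (IZR m * t))).

Lemma ccont_strip m u : ccont u -> ccont (strip m u).
Proof.
  intros H. apply ccont_minus; auto. apply ccont_mult; [apply ccont_const | apply ccont_cexpi_lin].
Qed.

Lemma fc_strip m n u : ccont u -> n <> m -> fc n (strip m u) = fc n u.
Proof.
  intros H Hn. unfold strip.
  rewrite fc_minus, fc_mult_l, fc_cexpi; auto using ccont_cexpi_lin.
  - destruct (Z.eq_dec m n); [congruence|]. ring.
  - apply ccont_mult; [apply ccont_const | apply ccont_cexpi_lin].
Qed.

(** Pythagoras. In the expanded square the cross terms are linear in the integral of [w], which is
    [2 * PI] times the coefficient; they contribute [-2], and the square of the removed mode [+1],
    times [2 * PI * normsq (fc m u)]. *)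
Lemma energy_strip m u : ccont u -> energy (strip m u) = energy u - 2 * PI * normsq (fc m u).
Proof.
  intros H. pose proof PI_neq0.
  set (w := fun t => Cmult (u t) (cexpi (- (IZR m * t)))).
  assert (Hw : ccont w) by now apply ccont_fc_integrand.
  assert (Ew : CRInt w 0 (2 * PI) = Cmult (RtoC (2 * PI)) (fc m u)).
  { unfold fc. fold w. rewrite Cmult_assoc, <- RtoC_mult.
    replace (2 * PI * / (2 * PI)) with 1 by (field; auto). now rewrite Cmult_1_l. }
  destruct (fc m u) as [c1 c2] eqn:Ec.
  unfold energy.
  rewrite (RInt_ext _ (fun t => (1 * normsq (u t) + 1 * (c1 * c1 + c2 * c2)) +
                               (-2 * c1 * part true (w t) + -2 * c2 * part false (w t)))).
  2:{ intros t _. unfold strip. rewrite Ec. rewrite (Rmult_1_l (c1 * c1 + c2 * c2)).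
      replace (c1 * c1 + c2 * c2) with ((c1 * c1 + c2 * c2) * normsq (cexpi (IZR m * t)))
        by (rewrite normsq_cexpi; ring).
      unfold w, cexpi, normsq. rewrite cos_neg, sin_neg. destruct (u t) as [u1 u2]. simpl.
      ring. }
  rewrite (RInt_ext _ (fun t => 1 * (1 * normsq (u t) + 1 * (c1 * c1 + c2 * c2)) +
                               1 * (-2 * c1 * part true (w t) + -2 * c2 * part false (w t))))
    by (intros; simpl; ring).
  pose proof (continuous_normsq u H) as Cn.
  rewrite RInt_lin2.
  - rewrite (RInt_lin2 (fun t => normsq (u t)) (fun _ => c1 * c1 + c2 * c2) 1 1); [|auto|intros; apply continuous_const].
    rewrite (RInt_lin2 (fun t => part true (w t)) (fun t => part false (w t))); [|apply (Hw true)|apply (Hw false)].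
    rewrite <- !part_CRInt, Ew, RInt_cst. unfold normsq. simpl. ring.
  - intros x. apply (continuous_plus (V := R_NormedModule) (fun t => 1 * normsq (u t))).
    + apply (continuous_scal_r (V := R_NormedModule) 1), Cn.
    + apply continuous_const.
  - intros x. apply (continuous_plus (V := R_NormedModule) (fun t => -2 * c1 * part true (w t)));
      apply (continuous_scal_r (V := R_NormedModule)), Hw.
Qed.

(* Strip the Fourier modes off one at a time: orthogonality leaves the other coefficients unchanged. *)
Lemma bessel (l : list Z) : NoDup l -> forall u, ccont u ->
  2 * PI * sumR (map (fun m => normsq (fc m u)) l) <= energy u.
Proof.
  pose proof two_PI_pos as HP.
  induction 1 as [|m l Hm Hl IH]; intros u Hu.
  - simpl. rewrite Rmult_0_r. unfold energy. apply RInt_ge_0; [lra | |].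
    + apply continuous_ex_RInt, continuous_normsq, Hu.
    + intros; apply normsq_nonneg.
  - specialize (IH (strip m u) (ccont_strip m u Hu)). rewrite energy_strip in IH by auto.
    rewrite (map_ext_in _ (fun m => normsq (fc m u))) in IH.
    + simpl. lra.
    + intros n Hn. rewrite fc_strip; auto. intros ->; contradiction.
Qed.

Lemma bessel_sup (l : list Z) u M : NoDup l -> ccont u -> (forall t, Cmod (u t) <= M) ->
  sumR (map (fun m => normsq (fc m u)) l) <= M * M.
Proof.
  intros Hl Hu HM. pose proof two_PI_pos as HP.
  apply (Rmult_le_reg_l (2 * PI)); [auto|].
  eapply Rle_trans; [now apply bessel|]. unfold energy.
  apply Rle_trans with (RInt (fun _ => M * M) 0 (2 * PI)); [|rewrite RInt_cst; lra].
  apply RInt_le; [lra | apply continuous_ex_RInt, continuous_normsq, Hu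
    | apply continuous_ex_RInt; intros; apply continuous_const |].
  intros t _. rewrite normsq_Cmod. pose proof (Cmod_ge_0 (u t)).
  apply Rmult_le_compat; auto.
Qed.

(** * Fejer means *)

Lemma lsum_cons (T : Type) (F : T -> C) a l : lsum F (a :: l) = Cplus (F a) (lsum F l).
Proof. reflexivity. Qed.

Lemma lsum_app (T : Type) (F : T -> C) l l' : lsum F (l ++ l') = Cplus (lsum F l) (lsum F l').
Proof.
  induction l as [|a l IH]; simpl; [unfold lsum at 2; simpl; ring|].
  rewrite !lsum_cons, IH. ring.
Qed.

Lemma lsum_ext_in (T : Type) (F G : T -> C) l : (forall a, In a l -> F a = G a) -> lsum F l = lsum G l.
Proof. intros H. unfold lsum. f_equal. now apply map_ext_in. Qed.

Lemma lsum_plus (T : Type) (F G : T -> C) l :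
  lsum (fun a => Cplus (F a) (G a)) l = Cplus (lsum F l) (lsum G l).
Proof.
  induction l as [|a l IH]; [unfold lsum; simpl; ring|]. rewrite !lsum_cons, IH. ring.
Qed.

Lemma lsum_mult_l (T : Type) c (F : T -> C) l :
  lsum (fun a => Cmult c (F a)) l = Cmult c (lsum F l).
Proof.
  induction l as [|a l IH]; [unfold lsum; simpl; ring|]. rewrite !lsum_cons, IH. ring.
Qed.

Lemma lsum_perm (T : Type) (F : T -> C) l l' : Permutation l l' -> lsum F l = lsum F l'.
Proof.
  induction 1; rewrite ?lsum_cons; auto; [congruence | ring | congruence].
Qed.

Lemma lsum_map (S T : Type) (g : S -> T) (F : T -> C) l : lsum F (map g l) = lsum (fun a => F (g a)) l.
Proof. unfold lsum. now rewrite map_map. Qed.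

Lemma lsum_list_prod (S T : Type) (F : S * T -> C) l l' :
  lsum F (list_prod l l') = lsum (fun a => lsum (fun b => F (a, b)) l') l.
Proof.
  induction l as [|a l IH]; [reflexivity|]. simpl list_prod.
  now rewrite lsum_app, lsum_map, lsum_cons, IH.
Qed.

Lemma lsum_filter (T : Type) (F : T -> C) p l :
  lsum F l = Cplus (lsum F (filter p l)) (lsum F (filter (fun a => negb (p a)) l)).
Proof.
  induction l as [|a l IH]; [unfold lsum; simpl; ring|]. rewrite lsum_cons, IH. simpl.
  destruct (p a); simpl; rewrite lsum_cons; ring.
Qed.

Lemma sumR_filter (T : Type) (F : T -> R) p l :
  sumR (map F l) = sumR (map F (filter p l)) + sumR (map F (filter (fun a => negb (p a)) l)).
Proof.
  induction l as [|a l IH]; [simpl; ring|]. simpl. rewrite IH.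
  destruct (p a); simpl; ring.
Qed.

Lemma sumR_le (T : Type) (F G : T -> R) l : (forall a, In a l -> F a <= G a) ->
  sumR (map F l) <= sumR (map G l).
Proof.
  induction l as [|a l IH]; intros H; simpl; [lra|].
  assert (F a <= G a) by (apply H; left; auto).
  assert (sumR (map F l) <= sumR (map G l)) by (apply IH; intros; apply H; right; auto). lra.
Qed.

Lemma sumR_mult_l (T : Type) c (F : T -> R) l : sumR (map (fun a => c * F a) l) = c * sumR (map F l).
Proof. induction l as [|a l IH]; simpl; [ring | rewrite IH; ring]. Qed.

Lemma Cmod_lsum_le (T : Type) (F : T -> C) l : Cmod (lsum F l) <= sumR (map (fun a => Cmod (F a)) l).
Proof.
  induction l as [|a l IH]; [unfold lsum; simpl; rewrite Cmod_0; lra|].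
  rewrite lsum_cons. eapply Rle_trans; [apply Cmod_triangle|]. simpl. lra.
Qed.

Lemma lsum_zero (T : Type) (F : T -> C) l : (forall a, In a l -> F a = RtoC 0) -> lsum F l = RtoC 0.
Proof.
  induction l as [|a l IH]; intros H; [reflexivity|].
  rewrite lsum_cons, (H a) by (left; auto). rewrite IH by (intros b Hb; apply H; right; auto). ring.
Qed.

Lemma lsum_single (T : Type) (F : T -> C) l a : NoDup l -> In a l ->
  (forall b, In b l -> b <> a -> F b = RtoC 0) -> lsum F l = F a.
Proof.
  induction 1 as [|c l Hc Hl IH]; intros Ha H0; [destruct Ha|]. rewrite lsum_cons.
  destruct Ha as [->|Ha].
  - rewrite lsum_zero; [ring|]. intros b Hb. apply H0; [right; auto|]. congruence.
  - rewrite IH; auto.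
    + rewrite H0; [ring | left; auto |]. congruence.
    + intros b Hb. apply H0. right; auto.
Qed.

Lemma lsum_const (T : Type) (c : C) (l : list T) : lsum (fun _ => c) l = Cmult (RtoC (INR (length l))) c.
Proof.
  induction l as [|a l IH]; [unfold lsum; simpl; ring|]. rewrite lsum_cons, IH.
  cbn [length]. rewrite S_INR, RtoC_plus. ring.
Qed.

Lemma lsum_seq_S (F : nat -> C) n : lsum F (seq 0 (S n)) = Cplus (lsum F (seq 0 n)) (F n).
Proof. rewrite seq_S, lsum_app. f_equal. unfold lsum; simpl. ring. Qed.

Lemma lsum_seq_rev (F : nat -> C) n :
  lsum (fun j => F (n - j)%nat) (seq 0 n) = lsum (fun j => F (S j)) (seq 0 n).
Proof.
  rewrite <- (lsum_map _ _ (fun j => (n - j)%nat) F), <- (lsum_map _ _ S F). apply lsum_perm.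
  apply NoDup_Permutation.
  - apply FinFun.Injective_map_NoDup_in; [|apply seq_NoDup].
    intros x y Hx Hy. apply in_seq in Hx, Hy. lia.
  - apply FinFun.Injective_map_NoDup; [|apply seq_NoDup]. intros x y; lia.
  - intros z. rewrite !in_map_iff. split; intros [j [<- Hj]]; apply in_seq in Hj.
    + exists (n - j - 1)%nat. rewrite in_seq. lia.
    + exists (n - S j)%nat. rewrite in_seq. lia.
Qed.

Definition Zlist (h : nat) : list Z := map (fun i => (Z.of_nat i - Z.of_nat h)%Z) (seq 0 (2 * h + 1)).

Lemma in_Zlist h z : In z (Zlist h) <-> (- Z.of_nat h <= z <= Z.of_nat h)%Z.
Proof.
  unfold Zlist. rewrite in_map_iff. split.
  - intros [i [<- Hi]]. apply in_seq in Hi. lia.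
  - intros H. exists (Z.to_nat (z + Z.of_nat h)). rewrite in_seq. lia.
Qed.

Lemma NoDup_Zlist h : NoDup (Zlist h).
Proof. apply FinFun.Injective_map_NoDup; [intros x y; lia | apply seq_NoDup]. Qed.

Lemma lsum_Zlist_S (G : Z -> C) h :
  lsum G (Zlist (S h)) = Cplus (lsum G (Zlist h)) (Cplus (G (Z.of_nat (S h))) (G (- Z.of_nat (S h))%Z)).
Proof.
  rewrite (lsum_perm _ G (Zlist (S h)) (Z.of_nat (S h) :: (- Z.of_nat (S h))%Z :: Zlist h)).
  - rewrite !lsum_cons. ring.
  - apply NoDup_Permutation.
    + apply NoDup_Zlist.
    + constructor; [|constructor; [|apply NoDup_Zlist]]; cbn [In]; rewrite in_Zlist; lia.
    + intros z. cbn [In]. rewrite !in_Zlist. lia.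
Qed.

Lemma lsum_Zlist_fold (G : Z -> C) h :
  lsum G (Zlist h) = lsum (fun n => match n with
                                    | O => G 0%Z
                                    | S _ => Cplus (G (Z.of_nat n)) (G (- Z.of_nat n)%Z)
                                    end) (seq 0 (S h)).
Proof.
  induction h as [|h IH].
  - unfold Zlist, lsum; simpl. reflexivity.
  - rewrite lsum_Zlist_S, lsum_seq_S, IH. reflexivity.
Qed.

(** Among the pairs of indices from [0] to [h], the difference [z] occurs [h + 1 - |z|] times. This
    turns the double sum in [sigma] into triangular weights. *)
Lemma lsum_toeplitz (G : Z -> C) h :
  lsum (fun j => lsum (fun l => G (Z.of_nat j - Z.of_nat l)%Z) (seq 0 (S h))) (seq 0 (S h))
  = lsum (fun z => Cmult (RtoC (INR (S h) - IZR (Z.abs z))) (G z)) (Zlist h).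
Proof.
  induction h as [|h IH].
  - unfold Zlist, lsum; simpl. rewrite !Rminus_0_r. ring.
  - rewrite lsum_seq_S, (lsum_seq_S _ (S h)).
    rewrite (lsum_ext_in _ _ (fun j => Cplus (lsum (fun l => G (Z.of_nat j - Z.of_nat l)%Z) (seq 0 (S h)))
                                            (G (Z.of_nat j - Z.of_nat (S h))%Z)))
      by (intros; apply lsum_seq_S).
    rewrite lsum_plus, IH, Z.sub_diag.
    rewrite (lsum_Zlist_S (fun z => Cmult (RtoC (INR (S (S h)) - IZR (Z.abs z))) (G z))).
    rewrite (lsum_ext_in _ (fun z => Cmult (RtoC (INR (S (S h)) - IZR (Z.abs z))) (G z))
               (fun z => Cplus (Cmult (RtoC (INR (S h) - IZR (Z.abs z))) (G z)) (G z))).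
    2:{ intros z _. rewrite (S_INR (S h)).
        replace (INR (S h) + 1 - IZR (Z.abs z)) with (INR (S h) - IZR (Z.abs z) + 1) by ring.
        rewrite RtoC_plus. ring. }
    rewrite lsum_plus.
    assert (W : INR (S (S h)) - IZR (Z.of_nat (S h)) = 1) by (rewrite <- INR_IZR_INZ, (S_INR (S h)); ring).
    rewrite (Z.abs_opp (Z.of_nat (S h))), Z.abs_eq, W by lia.
    rewrite !Cmult_1_l.
    (* Enlarging the square by one adds a column with the negative differences, a row with the
       positive ones, and the corner [0]: every element of [Zlist (S h)] exactly once. *)
    assert (K : Cplus (lsum (fun j => G (Z.of_nat j - Z.of_nat (S h))%Z) (seq 0 (S h)))
                 (Cplus (lsum (fun l => G (Z.of_nat (S h) - Z.of_nat l)%Z) (seq 0 (S h))) (G 0%Z))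
                = Cplus (lsum G (Zlist h)) (Cplus (G (Z.of_nat (S h))) (G (- Z.of_nat (S h))%Z))).
    { rewrite <- lsum_Zlist_S, lsum_Zlist_fold.
      rewrite (lsum_ext_in _ (fun j => G (Z.of_nat j - Z.of_nat (S h))%Z)
                 (fun j => (fun i => G (- Z.of_nat i)%Z) (S h - j)%nat)).
      2:{ intros j Hj. apply in_seq in Hj. f_equal. lia. }
      rewrite (lsum_seq_rev (fun i => G (- Z.of_nat i)%Z)).
      rewrite (lsum_ext_in _ (fun l => G (Z.of_nat (S h) - Z.of_nat l)%Z)
                 (fun j => (fun i => G (Z.of_nat i)) (S h - j)%nat)).
      2:{ intros j Hj. apply in_seq in Hj. f_equal. lia. }
      rewrite (lsum_seq_rev (fun i => G (Z.of_nat i))).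
      change (seq 0 (S (S h))) with (0%nat :: seq 1 (S h)).
      rewrite lsum_cons, <- seq_shift, lsum_map, lsum_plus. ring. }
    rewrite <- Cplus_assoc, K. ring.
Qed.

(** One-sided, unlike the usual Dirichlet kernel: its squared modulus is the sum of all
    [cexpi ((j - l) * x)], which makes the Fejer kernel visibly nonnegative. *)
Definition dirichlet (N : nat) (x : R) : C := lsum (fun j => cexpi (INR j * x)) (seq 0 N).

Definition fejer (N : nat) (x : R) : R := normsq (dirichlet N x) / INR N.

Lemma Cconj_lsum (T : Type) (F : T -> C) l : Cconj (lsum F l) = lsum (fun a => Cconj (F a)) l.
Proof.
  induction l as [|a l IH].
  - unfold lsum, Cconj; simpl. unfold RtoC. f_equal. ring.
  - rewrite !lsum_cons, <- IH. destruct (F a), (lsum F l). unfold Cconj, Cplus; simpl. f_equal. ring.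
Qed.

Lemma dirichlet_normsq N x :
  lsum (fun j => lsum (fun l => cexpi (IZR (Z.of_nat j - Z.of_nat l) * x)) (seq 0 N)) (seq 0 N)
  = RtoC (normsq (dirichlet N x)).
Proof.
  transitivity (Cmult (dirichlet N x) (Cconj (dirichlet N x))).
  2:{ destruct (dirichlet N x). unfold normsq, Cconj, Cmult, RtoC; simpl. f_equal; ring. }
  unfold dirichlet at 2. rewrite Cconj_lsum.
  rewrite Cmult_comm. unfold dirichlet. rewrite <- lsum_mult_l. apply lsum_ext_in. intros j _.
  rewrite Cmult_comm, <- lsum_mult_l. apply lsum_ext_in. intros l _.
  rewrite minus_IZR, <- !INR_IZR_INZ.
  replace ((INR j - INR l) * x) with (INR j * x + - (INR l * x)) by ring. rewrite cexpi_plus. f_equal.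
  unfold cexpi, Cconj; simpl. now rewrite cos_neg, sin_neg.
Qed.

Lemma fejer_nonneg N x : 0 <= fejer N x.
Proof.
  unfold fejer. destruct N as [|N].
  - unfold dirichlet, lsum, normsq; simpl. unfold Rdiv. rewrite Rmult_0_l, Rplus_0_l, Rmult_0_l. lra.
  - apply Rmult_le_pos; [apply normsq_nonneg|]. left. apply Rinv_0_lt_compat, lt_0_INR. lia.
Qed.

Lemma normsq_cexpi_minus_1 z : normsq (Cminus (cexpi z) (RtoC 1)) = 4 * (sin (z / 2) * sin (z / 2)).
Proof.
  unfold normsq, cexpi; simpl.
  assert (E : cos z = 1 - 2 * (sin (z / 2) * sin (z / 2))).
  { replace z with (2 * (z / 2)) at 1 by field. rewrite cos_2a_sin. ring. }
  pose proof (sin2_cos2 z) as E2. unfold Rsqr in E2.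
  replace ((cos z + - (1)) * (cos z + - (1)) + (sin z + - 0) * (sin z + - 0))
    with ((sin z * sin z + cos z * cos z) + 1 - 2 * cos z) by ring.
  rewrite E2, E. ring.
Qed.

Lemma dirichlet_geometric N z :
  Cmult (Cminus (cexpi z) (RtoC 1)) (dirichlet N z) = Cminus (cexpi (INR N * z)) (RtoC 1).
Proof.
  induction N as [|N IH].
  - unfold dirichlet, lsum; simpl. rewrite Rmult_0_l, cexpi_0. ring.
  - unfold dirichlet in *. rewrite lsum_seq_S, Cmult_plus_distr_l, IH, S_INR.
    replace ((INR N + 1) * z) with (z + INR N * z) by ring. rewrite cexpi_plus. ring.
Qed.

(** The geometric sum gives [|e^(iz) - 1|^2 |D|^2 = |e^(iNz) - 1|^2 <= 4], and
    [|e^(iz) - 1|^2 = 4 sin^2(z/2)]. This is the only decay of the kernel away from the origin that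
    is used. *)
Lemma fejer_concentration N z : (1 <= N)%nat -> sin (z / 2) * sin (z / 2) * fejer N z <= / INR N.
Proof.
  intros HN. unfold fejer.
  assert (H : sin (z / 2) * sin (z / 2) * normsq (dirichlet N z) <= 1).
  { pose proof (f_equal normsq (dirichlet_geometric N z)) as E.
    rewrite normsq_mult, !normsq_cexpi_minus_1 in E.
    pose proof (SIN_bound (INR N * z / 2)). nra. }
  assert (0 < / INR N) by (apply Rinv_0_lt_compat, lt_0_INR; lia).
  unfold Rdiv. rewrite <- Rmult_assoc. nra.
Qed.

(** The Fejer mean as a double sum over [j] and [l]: in this form it matches both the squared
    modulus of [dirichlet] and the left side of [lsum_toeplitz]. *)
Definition sigma (N : nat) (u : R -> C) (x : R) : C :=
  Cmult (RtoC (/ INR N))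
    (lsum (fun j => lsum (fun l => Cmult (fc (Z.of_nat j - Z.of_nat l) u)
       (cexpi (IZR (Z.of_nat j - Z.of_nat l) * x))) (seq 0 N)) (seq 0 N)).

Lemma fc_modulate m u x : ccont u ->
  Cmult (fc m u) (cexpi (IZR m * x)) = fc 0 (fun y => Cmult (u y) (cexpi (IZR m * (x - y)))).
Proof.
  intros H. unfold fc. rewrite <- Cmult_assoc. f_equal. rewrite Cmult_comm, <- CRInt_mult_l.
  - apply CRInt_ext. intros y.
    replace (IZR m * (x - y)) with (IZR m * x + - (IZR m * y)) by ring.
    rewrite cexpi_plus, Rmult_0_l, Ropp_0, cexpi_0. ring.
  - now apply ccont_fc_integrand.
Qed.

Lemma ccont_cexpi_reflect m x : ccont (fun y => cexpi (IZR m * (x - y))).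
Proof.
  apply (ccont_ext (fun y => cexpi ((- IZR m) * y + IZR m * x))); [intros; f_equal; ring|].
  apply ccont_comp_affine, ccont_cexpi.
Qed.

Lemma ccont_fejer N x : ccont (fun y => RtoC (fejer N (x - y))).
Proof.
  apply (ccont_ext (fun y => Cmult (RtoC (/ INR N))
    (lsum (fun j => lsum (fun l => cexpi (IZR (Z.of_nat j - Z.of_nat l) * (x - y))) (seq 0 N)) (seq 0 N)))).
  - intros y. rewrite dirichlet_normsq, <- RtoC_mult. f_equal. unfold fejer, Rdiv. ring.
  - apply ccont_mult; [apply ccont_const|].
    apply (ccont_lsum _ (fun j y => lsum (fun l => cexpi (IZR (Z.of_nat j - Z.of_nat l) * (x - y))) (seq 0 N))).
    intros j. apply (ccont_lsum _ (fun l y => cexpi (IZR (Z.of_nat j - Z.of_nat l) * (x - y)))).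
    intros l. apply ccont_cexpi_reflect.
Qed.

(** Convolution with the Fejer kernel; [fc 0] plays the role of the normalised integral over a
    period. *)
Lemma sigma_kernel N u x : ccont u -> sigma N u x = fc 0 (fun y => Cmult (u y) (RtoC (fejer N (x - y)))).
Proof.
  intros H. unfold sigma.
  assert (Hjl : forall j l, ccont (fun y => Cmult (u y) (cexpi (IZR (Z.of_nat j - Z.of_nat l) * (x - y)))))
    by (intros; apply ccont_mult; [auto | apply ccont_cexpi_reflect]).
  rewrite (lsum_ext_in _ _ (fun j => fc 0 (fun y => lsum (fun l =>
     Cmult (u y) (cexpi (IZR (Z.of_nat j - Z.of_nat l) * (x - y)))) (seq 0 N)))).
  - rewrite <- (fc_lsum _ 0 (fun j y => lsum (fun l =>
       Cmult (u y) (cexpi (IZR (Z.of_nat j - Z.of_nat l) * (x - y)))) (seq 0 N))).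
    + rewrite <- fc_mult_l.
      * apply fc_ext. intros y.
        rewrite (lsum_ext_in _ _ (fun j => Cmult (u y) (lsum (fun l =>
          cexpi (IZR (Z.of_nat j - Z.of_nat l) * (x - y))) (seq 0 N)))) by (intros; apply lsum_mult_l).
        rewrite lsum_mult_l, dirichlet_normsq. unfold fejer, Rdiv. rewrite RtoC_mult. ring.
      * apply (ccont_lsum _ (fun j y => lsum (fun l =>
          Cmult (u y) (cexpi (IZR (Z.of_nat j - Z.of_nat l) * (x - y)))) (seq 0 N))).
        intros j. apply (ccont_lsum _ (fun l y => Cmult (u y) (cexpi (IZR (Z.of_nat j - Z.of_nat l) * (x - y))))); auto.
    + intros j. apply (ccont_lsum _ (fun l y => Cmult (u y) (cexpi (IZR (Z.of_nat j - Z.of_nat l) * (x - y))))); auto.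
  - intros j _. rewrite (fc_lsum _ 0 (fun l y => Cmult (u y) (cexpi (IZR (Z.of_nat j - Z.of_nat l) * (x - y))))); auto.
    apply lsum_ext_in. intros l _. now apply fc_modulate.
Qed.

Lemma fc_const m : fc m (fun _ => RtoC 1) = RtoC (if Z.eq_dec 0 m then 1 else 0).
Proof.
  rewrite <- fc_cexpi. apply fc_ext. intros t. rewrite Rmult_0_l. symmetry. apply cexpi_0.
Qed.

Lemma sigma_const N x : (1 <= N)%nat -> sigma N (fun _ => RtoC 1) x = RtoC 1.
Proof.
  intros HN. unfold sigma.
  rewrite (lsum_ext_in _ _ (fun _ => RtoC 1)).
  - rewrite lsum_const, length_seq, Cmult_1_r, <- RtoC_mult. f_equal. field. apply not_0_INR. lia.
  - intros j Hj. rewrite (lsum_single _ _ _ j); auto using seq_NoDup.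
    + rewrite Z.sub_diag, fc_const, Rmult_0_l, cexpi_0. simpl. ring.
    + intros l _ Hl. rewrite fc_const. destruct (Z.eq_dec 0 (Z.of_nat j - Z.of_nat l)); [lia|]. ring.
Qed.

Lemma fc0_window u a : ccont u -> cper u ->
  fc 0 u = Cmult (RtoC (/ (2 * PI))) (CRInt u a (a + 2 * PI)).
Proof.
  intros H P. unfold fc. f_equal. rewrite (CRInt_ext _ u).
  - apply C_eq_part. intros b. rewrite !part_CRInt. symmetry.
    apply (RInt_periodic (fun t => part b (u t))); [apply H|]. intros; now rewrite P.
  - intros t. rewrite Rmult_0_l, Ropp_0, cexpi_0. ring.
Qed.

Lemma fejer_periodic N x : cper (fun y => RtoC (fejer N (x - y))).
Proof.
  intros y. unfold fejer.
  replace (dirichlet N (x - (y + 2 * PI))) with (dirichlet N (x - y)); auto.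
  apply lsum_ext_in. intros j _. symmetry.
  rewrite INR_IZR_INZ. rewrite <- (cexpi_periodic (Z.of_nat j) (x - (y + 2 * PI))). do 2 f_equal. ring.
Qed.

(** The mass of the kernel is read off from the Fejer mean of the constant [1], in which only the
    diagonal terms survive. *)
Lemma RInt_fejer N x : (1 <= N)%nat -> RInt (fun y => fejer N (x - y)) (x - PI) (x - PI + 2 * PI) = 2 * PI.
Proof.
  intros HN. pose proof (sigma_const N x HN) as E.
  rewrite sigma_kernel in E by apply ccont_const.
  rewrite (fc_ext 0 _ (fun y => RtoC (fejer N (x - y)))) in E by (intros; ring).
  rewrite (fc0_window _ (x - PI)) in E; [|apply ccont_fejer|apply fejer_periodic].
  apply (f_equal (Cmult (RtoC (2 * PI)))) in E.
  rewrite Cmult_assoc, <- RtoC_mult, Rinv_r, Cmult_1_l, Cmult_1_r in E by (pose proof two_PI_pos; lra).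
  apply (f_equal Re) in E. exact E.
Qed.

(** Against the kernel the constant [A] has mean [A], and [fejer_concentration] bounds the mean of
    the [sin^2] term by [D / N]. The period is centred at [x], so the majorant is needed for
    [Rabs (x - y) <= PI] only. *)
Lemma sigma_majorant N u x A D : (1 <= N)%nat -> ccont u -> cper u -> 0 <= D ->
  (forall y, Rabs (x - y) <= PI -> Cmod (u y) <= A + D * (sin ((x - y) / 2) * sin ((x - y) / 2))) ->
  Cmod (sigma N u x) <= 2 * (A + D * / INR N).
Proof.
  intros HN Hu Pu HD H. pose proof two_PI_pos as HP. pose proof PI_neq0.
  rewrite sigma_kernel by auto.
  assert (Hc : ccont (fun y => Cmult (u y) (RtoC (fejer N (x - y))))) by (apply ccont_mult; auto using ccont_fejer).
  rewrite (fc0_window _ (x - PI)); [|auto|].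
  2:{ intros y. rewrite Pu. f_equal. apply fejer_periodic. }
  rewrite Cmod_mult, Cmod_R, Rabs_pos_eq by (left; now apply Rinv_0_lt_compat).
  assert (Cf : forall y, continuous (fun y => fejer N (x - y)) y) by exact (ccont_fejer N x true).
  apply Rle_trans with (/ (2 * PI) * (2 * RInt (fun y => A * fejer N (x - y) + (D * / INR N) * 1) (x - PI) (x - PI + 2 * PI))).
  - apply Rmult_le_compat_l; [left; now apply Rinv_0_lt_compat|].
    apply Cmod_CRInt_le; [lra | auto | |].
    + intros y. apply (continuous_plus (V := R_NormedModule) (fun y => A * fejer N (x - y))).
      * apply (continuous_scal_r (V := R_NormedModule)), Cf.
      * apply continuous_const.
    + intros y Hy. rewrite Cmod_mult, Cmod_R, Rabs_pos_eq by apply fejer_nonneg.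
      pose proof (fejer_nonneg N (x - y)) as F0.
      pose proof (fejer_concentration N (x - y) HN) as F1.
      assert (HA : Rabs (x - y) <= PI) by (apply Rabs_le; lra).
      specialize (H y HA).
      apply (Rmult_le_compat_r (fejer N (x - y))) in H; auto.
      apply (Rmult_le_compat_l D) in F1; auto. lra.
  - rewrite (RInt_lin2 (fun y => fejer N (x - y)) (fun _ => 1) A (D * / INR N)); [|auto|intros; apply continuous_const].
    rewrite RInt_cst, RInt_fejer by auto. right. field. split; auto. apply not_0_INR. lia.
Qed.

Lemma sin_ge_half z : 0 <= z <= PI / 2 -> z / 2 <= sin z.
Proof.
  intros [Hz0 Hz1].
  (* Hence [z <= 1.7] and [z^2 <= 3], so the Taylor bound [z - z^3/6 <= sin z] is at least [z/2]. *)
  assert (HP : PI < 3.4).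
  { pose proof (PI_ineq 2) as [_ K]. unfold PI_tg, tg_alt in K; simpl in K. lra. }
  destruct (sin_bound z 0) as [K _]; [lra | lra |].
  eapply Rle_trans; [|exact K]. unfold sin_approx, sin_term; simpl.
  assert (z * z <= 3) by nra. nra.
Qed.

Lemma Rabs_le_sin_half z : Rabs z <= PI -> Rabs z <= 4 * Rabs (sin (z / 2)).
Proof.
  intros H. unfold Rabs in H. destruct (Rcase_abs z).
  - assert (K : - z / 2 / 2 <= sin (- z / 2)) by (apply sin_ge_half; lra).
    replace (- z / 2) with (- (z / 2)) in K at 2 by field. rewrite sin_neg in K.
    rewrite Rabs_left by lra. rewrite Rabs_left by lra. lra.
  - assert (K : z / 2 / 2 <= sin (z / 2)) by (apply sin_ge_half; lra).
    rewrite Rabs_pos_eq by lra. rewrite Rabs_pos_eq by lra. lra.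
Qed.

Lemma sigma_bounded N u x A : (1 <= N)%nat -> ccont u -> cper u -> (forall y, Cmod (u y) <= A) ->
  Cmod (sigma N u x) <= 2 * A.
Proof.
  intros HN Hu Pu H. replace (2 * A) with (2 * (A + 0 * / INR N)) by ring.
  apply sigma_majorant; auto; [lra|]. intros y _. specialize (H y). lra.
Qed.

Lemma sigma_minus N u v x : ccont u -> ccont v ->
  sigma N (fun y => Cminus (u y) (v y)) x = Cminus (sigma N u x) (sigma N v x).
Proof.
  intros Hu Hv. assert (Hf := ccont_fejer N x).
  rewrite !sigma_kernel; auto using ccont_minus.
  rewrite <- fc_minus by (apply ccont_mult; auto). apply fc_ext. intros; ring.
Qed.

Lemma sigma_mult_l N c u x : ccont u -> sigma N (fun y => Cmult c (u y)) x = Cmult c (sigma N u x).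
Proof.
  intros Hu. assert (Hf := ccont_fejer N x).
  assert (Hcu : ccont (fun y => Cmult c (u y))) by (apply ccont_mult; auto using ccont_const).
  rewrite !sigma_kernel; auto.
  rewrite <- fc_mult_l by (apply ccont_mult; auto). apply fc_ext. intros; ring.
Qed.

(** With [s = sin ((x - y) / 2)], the Lipschitz bound gives at most [4 L |s|], and
    [|s| <= e + s^2 / e] puts this into the shape required by [sigma_majorant]. The parameter [e]
    stays free and is sent to zero in [le_of_limit]. *)
Lemma sigma_approx N u x L e : (1 <= N)%nat -> cper u -> 0 < e ->
  (forall y z, Cmod (Cminus (u y) (u z)) <= L * Rabs (y - z)) ->
  Cmod (Cminus (sigma N u x) (u x)) <= 8 * L * (e + / e * / INR N).
Proof.
  intros HN Pu He HL. assert (Hu : ccont u) by now apply (ccont_lipschitz u L).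
  assert (L0 : 0 <= L).
  { specialize (HL 1 0). rewrite Rminus_0_r, Rabs_R1 in HL.
    pose proof (Cmod_ge_0 (Cminus (u 1) (u 0))). lra. }
  assert (Ie : 0 < / e) by now apply Rinv_0_lt_compat.
  replace (Cminus (sigma N u x) (u x)) with (sigma N (fun y => Cminus (u y) (Cmult (u x) (RtoC 1))) x).
  - replace (8 * L * (e + / e * / INR N)) with (2 * (4 * L * e + (4 * L * / e) * / INR N)) by ring.
    apply sigma_majorant; auto.
    + apply ccont_minus; auto using ccont_const.
    + intros y. now rewrite Pu.
    + apply Rmult_le_pos; lra.
    + intros y Hy. rewrite Cmult_1_r. eapply Rle_trans; [apply HL|].
      rewrite (Rabs_minus_sym y x). pose proof (Rabs_le_sin_half (x - y) Hy) as K.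
      set (s := sin ((x - y) / 2)) in *.
      assert (Q : Rabs s <= e + / e * (s * s)).
      { rewrite <- (Rabs_pos_eq (s * s)) by nra. rewrite Rabs_mult. set (q := Rabs s) in *.
        assert (0 <= q) by apply Rabs_pos.
        destruct (Rle_dec q e); [assert (0 <= / e * (q * q)) by (apply Rmult_le_pos; nra); lra|].
        assert (q <= / e * (q * q)); [|lra].
        apply (Rmult_le_reg_l e); [auto|]. rewrite <- Rmult_assoc, Rinv_r by lra. nra. }
      apply Rle_trans with (L * (4 * Rabs s)); [apply Rmult_le_compat_l; auto|].
      apply Rle_trans with (4 * L * (e + / e * (s * s))); [|right; ring].
      replace (L * (4 * Rabs s)) with (4 * L * Rabs s) by ring. apply Rmult_le_compat_l; lra.
  - rewrite (sigma_minus N u (fun _ => Cmult (u x) (RtoC 1))) by auto using ccont_const.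
    rewrite (sigma_mult_l N (u x) (fun _ => RtoC 1)) by apply ccont_const.
    rewrite sigma_const by auto. ring.
Qed.

(** * Double Fourier series *)

Record torus_lip (L : R) (g : R * R -> C) : Prop := {
  tl_lip1 : forall x2 x1 y1, Cmod (Cminus (g (x1, x2)) (g (y1, x2))) <= L * Rabs (x1 - y1);
  tl_lip2 : forall x1 x2 y2, Cmod (Cminus (g (x1, x2)) (g (x1, y2))) <= L * Rabs (x2 - y2);
  tl_per1 : forall x2 x1, g (x1 + 2 * PI, x2) = g (x1, x2);
  tl_per2 : forall x1 x2, g (x1, x2 + 2 * PI) = g (x1, x2) }.

Lemma torus_ccont1 L g x2 : torus_lip L g -> ccont (fun x1 => g (x1, x2)).
Proof. intros H. apply (ccont_lipschitz _ L). intros; apply (tl_lip1 L g H). Qed.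

Lemma torus_ccont2 L g x1 : torus_lip L g -> ccont (fun x2 => g (x1, x2)).
Proof. intros H. apply (ccont_lipschitz _ L). intros; apply (tl_lip2 L g H). Qed.

Definition inner (m : Z) (g : R * R -> C) (x2 : R) : C := fc m (fun x1 => g (x1, x2)).

Definition c2 (m n : Z) (g : R * R -> C) : C := fc n (inner m g).

Lemma inner_lip L g m : torus_lip L g ->
  forall x y, Cmod (Cminus (inner m g x) (inner m g y)) <= 2 * L * Rabs (x - y).
Proof.
  intros H x y. unfold inner. rewrite <- fc_minus by now apply (torus_ccont1 L).
  rewrite Rmult_assoc. apply Cmod_fc_le.
  - apply ccont_minus; now apply (torus_ccont1 L).
  - intros t. apply (tl_lip2 L g H).
Qed.

Lemma ccont_inner L g m : torus_lip L g -> ccont (inner m g).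
Proof. intros H. apply (ccont_lipschitz _ (2 * L)), inner_lip, H. Qed.

Lemma cper_inner L g m : torus_lip L g -> cper (inner m g).
Proof. intros H x. apply fc_ext. intros t. apply (tl_per2 L g H). Qed.

(** The inner integral of [cn] runs over the first variable, so pulling out the exponential in the
    second one leaves an iterated coefficient, without exchanging integrals. *)
Lemma cn_c2 L g m n : torus_lip L g -> cn (m, n) g = c2 m (Z.of_nat n) g.
Proof.
  intros H. unfold cn, c2, fc at 1.
  set (X := fun x2 => Cmult (CRInt (fun x1 => Cmult (g (x1, x2)) (cexpi (- (IZR m * x1)))) 0 (2 * PI))
                        (cexpi (- (IZR (Z.of_nat n) * x2)))).
  assert (E : forall x2, Cmult (RtoC (/ (2 * PI))) (X x2) = Cmult (inner m g x2) (cexpi (- (IZR (Z.of_nat n) * x2)))).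
  { intros x2. unfold inner, fc, X. ring. }
  assert (HX : ccont X).
  { apply (ccont_ext (fun x2 => Cmult (RtoC (2 * PI)) (Cmult (inner m g x2) (cexpi (- (IZR (Z.of_nat n) * x2)))))).
    - intros x2. rewrite <- E, Cmult_assoc, <- RtoC_mult, Rinv_r, Cmult_1_l; auto.
      pose proof two_PI_pos; lra.
    - apply ccont_mult; [apply ccont_const|]. apply ccont_fc_integrand, (ccont_inner L), H. }
  rewrite (CRInt_ext _ X).
  - rewrite <- (CRInt_ext _ _ _ _ E), CRInt_mult_l, Cmult_assoc, <- RtoC_mult by auto.
    do 2 f_equal. field. apply PI_neq0.
  - intros x2. unfold X. rewrite Cmult_comm, <- CRInt_mult_l.
    + apply CRInt_ext. intros x1. unfold ip; simpl fst; simpl snd. rewrite <- INR_IZR_INZ.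
      replace (- (IZR m * x1 + INR n * x2)) with (- (INR n * x2) + - (IZR m * x1)) by ring.
      rewrite cexpi_plus. ring.
    + apply ccont_fc_integrand, (torus_ccont1 L g x2 H).
Qed.

Lemma RInt_sumR (T : Type) (F : T -> R -> R) l a b : (forall i x, continuous (F i) x) ->
  (forall x, continuous (fun t => sumR (map (fun i => F i t) l)) x) /\
  RInt (fun t => sumR (map (fun i => F i t) l)) a b = sumR (map (fun i => RInt (F i) a b) l).
Proof.
  intros H. induction l as [|i l [IH1 IH2]]; simpl.
  - split; [intros; apply continuous_const|]. rewrite RInt_cst. ring.
  - split.
    + intros x. apply (continuous_plus (V := R_NormedModule) (F i)); auto.
    + rewrite (RInt_plus (V := R_CompleteNormedModule) (F i)) by (apply continuous_ex_RInt; auto).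
      unfold plus; simpl. now rewrite IH2.
Qed.

(** Bessel in the second variable bounds the sum over [n] by the energy of [inner m g]; under the
    integral, Bessel in the first variable bounds the sum over [m] pointwise by [G * G]. *)
Lemma bessel2 L g G l1 l2 : torus_lip L g -> NoDup l1 -> NoDup l2 -> (forall x, Cmod (g x) <= G) ->
  sumR (map (fun m => sumR (map (fun n => normsq (c2 m n g)) l2)) l1) <= G * G.
Proof.
  intros H N1 N2 HG. pose proof two_PI_pos as HP.
  apply (Rmult_le_reg_l (2 * PI)); [auto|]. rewrite <- sumR_mult_l.
  apply Rle_trans with (sumR (map (fun m => energy (inner m g)) l1)).
  - apply sumR_le. intros m _. apply (bessel l2 N2 (inner m g)), (ccont_inner L), H.
  - destruct (RInt_sumR Z (fun m t => normsq (inner m g t)) l1 0 (2 * PI)) as [K1 K2].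
    { intros m. apply continuous_normsq, (ccont_inner L), H. }
    apply Rle_trans with (RInt (fun t => sumR (map (fun m => normsq (inner m g t)) l1)) 0 (2 * PI));
      [right; symmetry; exact K2|].
    apply Rle_trans with (RInt (fun _ => G * G) 0 (2 * PI)); [|rewrite RInt_cst; lra].
    apply RInt_le; [lra | now apply continuous_ex_RInt
      | apply continuous_ex_RInt; intros; apply continuous_const |].
    intros t _. apply (bessel_sup l1 (fun x1 => g (x1, t))); auto. apply (torus_ccont1 L), H.
Qed.

Definition fd1 (t : R) (g : R * R -> C) (x : R * R) : C := Cminus (g (fst x + t, snd x)) (g x).
Definition fd2 (t : R) (g : R * R -> C) (x : R * R) : C := Cminus (g (fst x, snd x + t)) (g x).

Lemma Cmod_sub_sub a b c d p q : Cmod (Cminus a c) <= p -> Cmod (Cminus b d) <= q ->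
  Cmod (Cminus (Cminus a b) (Cminus c d)) <= p + q.
Proof.
  intros H1 H2. replace (Cminus (Cminus a b) (Cminus c d)) with (Cplus (Cminus a c) (Copp (Cminus b d))) by ring.
  eapply Rle_trans; [apply Cmod_triangle|]. rewrite Cmod_opp. lra.
Qed.

Lemma torus_lip_fd1 L g t : torus_lip L g -> torus_lip (2 * L) (fd1 t g).
Proof.
  intros [H1 H2 H3 H4]. split; intros; unfold fd1; simpl.
  - replace (2 * L * Rabs (x1 - y1)) with (L * Rabs (x1 + t - (y1 + t)) + L * Rabs (x1 - y1))
      by (replace (x1 + t - (y1 + t)) with (x1 - y1) by ring; ring).
    now apply Cmod_sub_sub.
  - replace (2 * L * Rabs (x2 - y2)) with (L * Rabs (x2 - y2) + L * Rabs (x2 - y2)) by ring.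
    now apply Cmod_sub_sub.
  - replace (x1 + 2 * PI + t) with (x1 + t + 2 * PI) by ring. now rewrite !H3.
  - now rewrite !H4.
Qed.

Lemma torus_lip_fd2 L g t : torus_lip L g -> torus_lip (2 * L) (fd2 t g).
Proof.
  intros [H1 H2 H3 H4]. split; intros; unfold fd2; simpl.
  - replace (2 * L * Rabs (x1 - y1)) with (L * Rabs (x1 - y1) + L * Rabs (x1 - y1)) by ring.
    now apply Cmod_sub_sub.
  - replace (2 * L * Rabs (x2 - y2)) with (L * Rabs (x2 + t - (y2 + t)) + L * Rabs (x2 - y2))
      by (replace (x2 + t - (y2 + t)) with (x2 - y2) by ring; ring).
    now apply Cmod_sub_sub.
  - now rewrite !H3.
  - replace (x2 + 2 * PI + t) with (x2 + t + 2 * PI) by ring. now rewrite !H4.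
Qed.

Lemma c2_fd1 L g t m n : torus_lip L g ->
  c2 m n (fd1 t g) = Cmult (Cminus (cexpi (IZR m * t)) (RtoC 1)) (c2 m n g).
Proof.
  intros H. unfold c2. rewrite <- fc_mult_l by now apply (ccont_inner L). apply fc_ext. intros x2.
  unfold inner, fd1; simpl.
  rewrite (fc_minus m (fun x1 => g (x1 + t, x2)) (fun x1 => g (x1, x2))).
  - rewrite (fc_shift m (fun x1 => g (x1, x2))); [ring | now apply (torus_ccont1 L)|].
    intros x1. apply (tl_per1 L g H).
  - apply (ccont_ext (fun x1 => g (1 * x1 + t, x2))); [intros; now rewrite Rmult_1_l|].
    apply (ccont_comp_affine (fun x1 => g (x1, x2))), (torus_ccont1 L), H.
  - now apply (torus_ccont1 L).
Qed.

Lemma c2_fd2 L g t m n : torus_lip L g ->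
  c2 m n (fd2 t g) = Cmult (Cminus (cexpi (IZR n * t)) (RtoC 1)) (c2 m n g).
Proof.
  intros H. unfold c2.
  rewrite (fc_ext n _ (fun x2 => Cminus (inner m g (x2 + t)) (inner m g x2))).
  - rewrite (fc_minus n (fun x2 => inner m g (x2 + t)) (inner m g)).
    + rewrite fc_shift; [ring | now apply (ccont_inner L) | now apply (cper_inner L)].
    + apply (ccont_ext (fun x2 => inner m g (1 * x2 + t))); [intros; now rewrite Rmult_1_l|].
      apply ccont_comp_affine, (ccont_inner L), H.
    + now apply (ccont_inner L).
  - intros x2. unfold inner, fd2; simpl. apply fc_minus; now apply (torus_ccont1 L).
Qed.

(** Each difference multiplies the coefficient by [e^(imt) - 1]. The Lipschitz property is carried
    along so that the differences qualify for [bessel2]. *)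
Lemma iter_fd1 L g t j : torus_lip L g ->
  torus_lip (2 ^ j * L) (Nat.iter j (fd1 t) g) /\
  forall m n, normsq (c2 m n (Nat.iter j (fd1 t) g))
    = normsq (Cminus (cexpi (IZR m * t)) (RtoC 1)) ^ j * normsq (c2 m n g).
Proof.
  intros H. induction j as [|j [IH1 IH2]].
  - simpl. rewrite Rmult_1_l. split; auto. intros; ring.
  - change (Nat.iter (S j) (fd1 t) g) with (fd1 t (Nat.iter j (fd1 t) g)). split.
    + simpl pow. rewrite Rmult_assoc. now apply torus_lip_fd1.
    + intros m n. rewrite (c2_fd1 _ _ t m n IH1), normsq_mult, IH2. simpl. ring.
Qed.

Lemma iter_fd2 L g t j : torus_lip L g ->
  torus_lip (2 ^ j * L) (Nat.iter j (fd2 t) g) /\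
  forall m n, normsq (c2 m n (Nat.iter j (fd2 t) g))
    = normsq (Cminus (cexpi (IZR n * t)) (RtoC 1)) ^ j * normsq (c2 m n g).
Proof.
  intros H. induction j as [|j [IH1 IH2]].
  - simpl. rewrite Rmult_1_l. split; auto. intros; ring.
  - change (Nat.iter (S j) (fd2 t) g) with (fd2 t (Nat.iter j (fd2 t) g)). split.
    + simpl pow. rewrite Rmult_assoc. now apply torus_lip_fd2.
    + intros m n. rewrite (c2_fd2 _ _ t m n IH1), normsq_mult, IH2. simpl. ring.
Qed.

(** Reflecting the second variable negates [n], and by the glide symmetry it equals a shift of the
    first variable by [PI], which multiplies the coefficient by [e^(im PI)]. *)
Lemma c2_symmetric L g m n : torus_lip L g -> (forall x1 x2, g (x1 + PI, - x2) = g (x1, x2)) ->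
  c2 m (- n) g = Cmult (RtoC (powerRZ (-1) m)) (c2 m n g).
Proof.
  intros H S. unfold c2. rewrite <- cexpi_PI_Z, <- fc_mult_l by now apply (ccont_inner L).
  rewrite <- fc_reflect; [|now apply (ccont_inner L)|now apply (cper_inner L)].
  apply fc_ext. intros x2. unfold inner.
  rewrite <- (fc_shift m (fun x1 => g (x1, x2))); [|now apply (torus_ccont1 L)|intros x1; apply (tl_per1 L g H)].
  apply fc_ext. intros x1. rewrite <- (S (x1 + PI) x2).
  replace (x1 + PI + PI) with (x1 + 2 * PI) by ring. now rewrite (tl_per1 L g H).
Qed.

Definition weight (h : nat) (z : Z) : R := (INR (S h) - IZR (Z.abs z)) / INR (S h).

Lemma sigma_weights h u x :
  sigma (S h) u x = lsum (fun z => Cmult (RtoC (weight h z)) (Cmult (fc z u) (cexpi (IZR z * x)))) (Zlist h).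
Proof.
  unfold sigma. rewrite (lsum_toeplitz (fun z => Cmult (fc z u) (cexpi (IZR z * x)))), <- lsum_mult_l.
  apply lsum_ext_in. intros z _. unfold weight, Rdiv. rewrite (RtoC_mult (_ - _)). ring.
Qed.

Definition sigma2 (h : nat) (g : R * R -> C) (x : R * R) : C :=
  sigma (S h) (fun y2 => sigma (S h) (fun y1 => g (y1, y2)) (fst x)) (snd x).

Lemma sigma_row_ccont h L g x1 : torus_lip L g ->
  ccont (fun y2 => sigma (S h) (fun y1 => g (y1, y2)) x1).
Proof.
  intros H. apply (ccont_ext (fun y2 => lsum (fun z => Cmult (RtoC (weight h z))
    (Cmult (inner z g y2) (cexpi (IZR z * x1)))) (Zlist h))).
  { intros y2. symmetry. apply sigma_weights. }
  apply (ccont_lsum _ (fun z y2 => Cmult (RtoC (weight h z)) (Cmult (inner z g y2) (cexpi (IZR z * x1))))).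
  intros z. apply ccont_mult; [apply ccont_const|]. apply ccont_mult; [now apply (ccont_inner L) | apply ccont_const].
Qed.

(** The error of the outer mean has constant [8]; the errors of the inner means, also [8], pass
    through the outer mean with the factor [2] of [sigma_bounded]. Hence [24]. *)
Lemma sigma2_approx h L g x e : torus_lip L g -> 0 < e ->
  Cmod (Cminus (sigma2 h g x) (g x)) <= 24 * L * (e + / e * / INR (S h)).
Proof.
  intros H He. destruct x as [x1 x2]. unfold sigma2; simpl fst; simpl snd.
  set (E := 8 * L * (e + / e * / INR (S h))).
  set (v := fun y2 => sigma (S h) (fun y1 => g (y1, y2)) x1).
  assert (Hv : ccont v) by exact (sigma_row_ccont h L g x1 H).
  assert (Hg : ccont (fun y2 => g (x1, y2))) by exact (torus_ccont2 L g x1 H).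
  assert (N1 : (1 <= S h)%nat) by lia.
  replace (Cminus (sigma (S h) v x2) (g (x1, x2))) with
    (Cplus (sigma (S h) (fun y2 => Cminus (v y2) (g (x1, y2))) x2)
           (Cminus (sigma (S h) (fun y2 => g (x1, y2)) x2) (g (x1, x2)))).
  2:{ rewrite (sigma_minus (S h) v (fun y2 => g (x1, y2))) by auto. ring. }
  eapply Rle_trans; [apply Cmod_triangle|].
  assert (K1 : Cmod (sigma (S h) (fun y2 => Cminus (v y2) (g (x1, y2))) x2) <= 2 * E).
  { apply sigma_bounded; auto using ccont_minus.
    - intros y2. unfold v. rewrite (tl_per2 L g H). f_equal. unfold sigma. f_equal.
      apply lsum_ext_in. intros j _. apply lsum_ext_in. intros l _. f_equal.
      apply fc_ext. intros t. apply (tl_per2 L g H).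
    - intros y2. apply (sigma_approx (S h) (fun y1 => g (y1, y2)) x1); auto.
      + intros y1. apply (tl_per1 L g H).
      + intros; apply (tl_lip1 L g H). }
  assert (K2 : Cmod (Cminus (sigma (S h) (fun y2 => g (x1, y2)) x2) (g (x1, x2))) <= E).
  { apply (sigma_approx (S h) (fun y2 => g (x1, y2)) x2); auto.
    - intros y2. apply (tl_per2 L g H).
    - intros; apply (tl_lip2 L g H). }
  unfold E in *. lra.
Qed.

Lemma lsum_swap (S T : Type) (F : S -> T -> C) l l' :
  lsum (fun a => lsum (F a) l') l = lsum (fun b => lsum (fun a => F a b) l) l'.
Proof.
  induction l as [|a l IH].
  - symmetry. apply lsum_zero. reflexivity.
  - rewrite lsum_cons, IH, <- lsum_plus. reflexivity.
Qed.

Definition box (h : nat) : list lattice := list_prod (Zlist h) (seq 0 (h + 1)).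

(** The weights are even, so by [c2_symmetric] the modes [n] and [-n] of the second variable combine
    into one term with [e_n], and the full lattice box folds onto the half box. *)
Lemma sigma2_box h L g x : torus_lip L g -> (forall x1 x2, g (x1 + PI, - x2) = g (x1, x2)) ->
  sigma2 h g x = lsum (fun n => Cmult (RtoC (weight h (fst n) * weight h (Z.of_nat (snd n))))
                                (Cmult (cn n g) (e_n n x))) (box h).
Proof.
  intros H Sy. destruct x as [x1 x2]. unfold sigma2; simpl fst; simpl snd.
  rewrite sigma_weights. unfold box. rewrite lsum_list_prod, Nat.add_1_r.
  transitivity (lsum (fun z2 => lsum (fun z1 => Cmult (RtoC (weight h z1 * weight h z2))
     (Cmult (c2 z1 z2 g) (Cmult (cexpi (IZR z1 * x1)) (cexpi (IZR z2 * x2))))) (Zlist h)) (Zlist h)).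
  - apply lsum_ext_in. intros z2 _.
    rewrite (fc_ext z2 _ (fun y2 => lsum (fun z1 => Cmult (Cmult (RtoC (weight h z1)) (cexpi (IZR z1 * x1)))
       (inner z1 g y2)) (Zlist h))).
    + rewrite (fc_lsum _ z2 (fun z1 y2 => Cmult (Cmult (RtoC (weight h z1)) (cexpi (IZR z1 * x1))) (inner z1 g y2))).
      * rewrite Cmult_assoc, (Cmult_comm (Cmult _ _)), Cmult_assoc, <- lsum_mult_l.
        apply lsum_ext_in. intros z1 _.
        rewrite fc_mult_l by now apply (ccont_inner L). fold (c2 z1 z2 g). rewrite RtoC_mult. ring.
      * intros z1. apply ccont_mult; [apply ccont_const | now apply (ccont_inner L)].
    + intros y2. rewrite sigma_weights. apply lsum_ext_in. intros z1 _. unfold inner. ring.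
  - rewrite (lsum_swap Z Z). apply lsum_ext_in. intros z1 _.
    rewrite lsum_Zlist_fold. apply lsum_ext_in. intros n _.
    rewrite (cn_c2 L) by auto. unfold e_n, ip; simpl fst; simpl snd. destruct n as [|n].
    + simpl INR. simpl Z.of_nat. rewrite !Rmult_0_l, Rplus_0_r, cexpi_0. ring.
    + rewrite (c2_symmetric L) by auto.
      assert (W : weight h (- Z.of_nat (S n)) = weight h (Z.of_nat (S n)))
        by (unfold weight; now rewrite Z.abs_opp).
      rewrite W, opp_IZR, <- INR_IZR_INZ, cexpi_plus.
      replace (IZR z1 * x1 - INR (S n) * x2) with (IZR z1 * x1 + - INR (S n) * x2) by ring.
      rewrite cexpi_plus. ring.
Qed.

(** * Decay of the coefficients *)

Lemma part_iter_fd1 b t j g x1 x2 :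
  part b (Nat.iter j (fd1 t) g (x1, x2)) = Nat.iter j (fd t) (fun s => part b (g (s, x2))) x1.
Proof.
  revert x1. induction j as [|j IH]; intros x1; [reflexivity|].
  change (Nat.iter (S j) (fd1 t) g) with (fd1 t (Nat.iter j (fd1 t) g)).
  unfold fd1 at 1. simpl fst; simpl snd. rewrite part_minus, !IH. reflexivity.
Qed.

Lemma part_iter_fd2 b t j g x1 x2 :
  part b (Nat.iter j (fd2 t) g (x1, x2)) = Nat.iter j (fd t) (fun s => part b (g (x1, s))) x2.
Proof.
  revert x2. induction j as [|j IH]; intros x2; [reflexivity|].
  change (Nat.iter (S j) (fd2 t) g) with (fd2 t (Nat.iter j (fd2 t) g)).
  unfold fd2 at 1. simpl fst; simpl snd. rewrite part_minus, !IH. reflexivity.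
Qed.

Lemma Cmod_le_of_parts z B : (forall b, Rabs (part b z) <= B) -> Cmod z <= 2 * B.
Proof.
  intros H. eapply Rle_trans; [apply Cmod_le_parts|].
  pose proof (H true); pose proof (H false). simpl in *. lra.
Qed.

Lemma smooth_lipschitz al k B u : al <= 1 -> (1 <= k)%nat -> smooth al k B u ->
  forall x y, Rabs (u x - u y) <= B * Rabs (x - y).
Proof.
  intros Hal Hk H x y. destruct k as [|k]; [lia|]. destruct H as [_ [u' [H1 H2]]].
  apply (Rabs_diff_le_derive u u'); auto. exact (smooth_bound _ _ _ _ H2).
Qed.

Lemma phi_periodic1 x1 x2 : phi (x1 + 2 * PI, x2) = phi (x1, x2).
Proof.
  simpl. now rewrite cos_plus, sin_plus, cos_2PI, sin_2PI, !Rmult_0_r, !Rmult_1_r, Rminus_0_r, Rplus_0_r.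
Qed.

Lemma phi_periodic2 x1 x2 : phi (x1, x2 + 2 * PI) = phi (x1, x2).
Proof.
  simpl. now rewrite cos_plus, sin_plus, cos_2PI, sin_2PI, !Rmult_0_r, !Rmult_1_r, Rminus_0_r, Rplus_0_r.
Qed.

Lemma phi_glide x1 x2 : phi (x1 + PI, - x2) = phi (x1, x2).
Proof. simpl. rewrite neg_cos, neg_sin, cos_neg, sin_neg. apply triple_eq; ring. Qed.

(** All that the Fourier argument needs from [tilde f]; the high-order information consists of
    differences in one variable at a time. *)
Record torus_smooth (k : nat) (al A : R) (g : R * R -> C) : Prop := {
  ts_lip : torus_lip A g;
  ts_glide : forall x1 x2, g (x1 + PI, - x2) = g (x1, x2);
  ts_fd1 : forall t x, 0 < t <= 1 -> Cmod (Nat.iter (S k) (fd1 t) g x) <= A * (t ^ k * Rpower t al);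
  ts_fd2 : forall t x, 0 < t <= 1 -> Cmod (Nat.iter (S k) (fd2 t) g x) <= A * (t ^ k * Rpower t al) }.

Lemma tilde_smooth U k al fs f : open3 U -> (forall x, sphere x -> U x) -> 0 <= al <= 1 ->
  (1 <= k)%nat -> Ckalpha U k al fs -> (forall x, sphere x -> fs x = f x) ->
  torus_smooth k al (2 * chain_const k * ext_value k al fs) (tilde f).
Proof.
  intros HU HS Hal Hk Hfs Hf. set (B := chain_const k * ext_value k al fs).
  replace (2 * chain_const k * ext_value k al fs) with (2 * B) by (unfold B; ring).
  assert (S1 : forall b x2, smooth al k B (fun s => part b (tilde f (s, x2)))).
  { intros b x2. apply (smooth_ext al k B (fun s => part b (fs (cos s * sin x2, sin s * sin x2, cos x2)))).
    - intros s. unfold tilde. f_equal. apply Hf, (sphere_phi s x2).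
    - apply (smooth_along_curve U k al fs (fun s => cos s * sin x2) (fun s => sin s * sin x2) (fun _ => cos x2)); auto.
      apply longitude_curve; lra. }
  assert (S2 : forall b x1, smooth al k B (fun s => part b (tilde f (x1, s)))).
  { intros b x1. apply (smooth_ext al k B (fun s => part b (fs (cos x1 * sin s, sin x1 * sin s, cos s)))).
    - intros s. unfold tilde. f_equal. apply Hf, (sphere_phi x1 s).
    - apply (smooth_along_curve U k al fs (fun s => cos x1 * sin s) (fun s => sin x1 * sin s) cos); auto.
      apply latitude_curve; lra. }
  split; [split| | |].
  - intros x2 x1 y1. rewrite Rmult_assoc. apply Cmod_le_of_parts. intros b. rewrite part_minus.
    apply (smooth_lipschitz al k B (fun s => part b (tilde f (s, x2)))); auto; lra.
  - intros x1 x2 y2. rewrite Rmult_assoc. apply Cmod_le_of_parts. intros b. rewrite part_minus.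
    apply (smooth_lipschitz al k B (fun s => part b (tilde f (x1, s)))); auto; lra.
  - intros x2 x1. unfold tilde. now rewrite phi_periodic1.
  - intros x1 x2. unfold tilde. now rewrite phi_periodic2.
  - intros x1 x2. unfold tilde. now rewrite phi_glide.
  - intros t [x1 x2] Ht. rewrite Rmult_assoc. apply Cmod_le_of_parts. intros b. rewrite part_iter_fd1.
    now apply iter_fd_bound.
  - intros t [x1 x2] Ht. rewrite Rmult_assoc. apply Cmod_le_of_parts. intros b. rewrite part_iter_fd2.
    now apply iter_fd_bound.
Qed.

Lemma sumR_app l l' : sumR (l ++ l') = sumR l + sumR l'.
Proof. induction l as [|a l IH]; simpl; [ring | rewrite IH; ring]. Qed.

Lemma sumR_list_prod (S T : Type) (F : S * T -> R) l l' :
  sumR (map F (list_prod l l')) = sumR (map (fun a => sumR (map (fun b => F (a, b)) l')) l).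
Proof.
  induction l as [|a l IH]; [reflexivity|]. simpl. now rewrite map_app, sumR_app, map_map, IH.
Qed.

Lemma sumR_map_nonneg (T : Type) (F : T -> R) l : (forall a, 0 <= F a) -> 0 <= sumR (map F l).
Proof. intros H. apply sumR_nonneg. intros x Hx. apply in_map_iff in Hx. now destruct Hx as [a [<- _]]. Qed.

Lemma sumR_incl (T : Type) (F : T -> R) l : (forall a, 0 <= F a) -> NoDup l ->
  forall l', incl l l' -> sumR (map F l) <= sumR (map F l').
Proof.
  intros HF. induction 1 as [|a l Ha Hl IH]; intros l' Hi; [now apply sumR_map_nonneg|].
  destruct (in_split a l') as (b1 & b2 & ->); [apply Hi; left; auto|].
  assert (K : sumR (map F l) <= sumR (map F (b1 ++ b2))).
  { apply IH. intros c Hc. assert (Hc' : In c (b1 ++ a :: b2)) by (apply Hi; right; auto).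
    apply in_app_iff in Hc'. apply in_app_iff. destruct Hc' as [|[->|]]; auto. contradiction. }
  rewrite !map_app, !sumR_app in *. simpl. lra.
Qed.

Lemma sumR_cauchy_schwarz (T : Type) (F : T -> R) l : (forall a, 0 <= F a) ->
  sumR (map F l) * sumR (map F l) <= INR (length l) * sumR (map (fun a => F a * F a) l).
Proof.
  intros HF. induction l as [|a l IH]; [simpl; lra|].
  cbn [length map]. rewrite S_INR. simpl sumR.
  set (s := sumR (map F l)) in *. set (q := sumR (map (fun a => F a * F a) l)) in *.
  set (n := INR (length l)) in *.
  assert (0 <= n) by apply pos_INR. assert (0 <= s) by now apply sumR_map_nonneg.
  assert (0 <= q) by (apply (sumR_map_nonneg _ (fun a => F a * F a)); intros; now apply Rmult_le_pos).
  assert (Hx := HF a). set (x := F a) in *.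
  (* After squaring, the induction hypothesis [s^2 <= n q] reduces this to the inequality of
     arithmetic and geometric means for [n x^2] and [q]. *)
  assert (K : 2 * x * s <= n * (x * x) + q).
  { apply Rsqr_incr_0_var; [|nra]. unfold Rsqr.
    apply Rle_trans with (4 * (x * x) * (n * q)); [nra|].
    assert (0 <= (n * (x * x) - q) * (n * (x * x) - q)) by apply Rle_0_sqr. nra. }
  nra.
Qed.

Lemma NoDup_list_prod (S T : Type) (l : list S) (l' : list T) : NoDup l -> NoDup l' -> NoDup (list_prod l l').
Proof.
  intros Hl Hl'. induction Hl as [|a l Ha Hl IH]; simpl; [constructor|].
  apply NoDup_app; auto.
  - apply FinFun.Injective_map_NoDup; auto. intros x y E. congruence.
  - intros [p q] H1 H2. apply in_map_iff in H1. destruct H1 as [y [E _]]. injection E as <- <-.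
    apply in_prod_iff in H2. tauto.
Qed.

Lemma NoDup_box h : NoDup (box h).
Proof. apply NoDup_list_prod; [apply NoDup_Zlist | apply seq_NoDup]. Qed.

Lemma in_box h n : In n (box h) <-> (Z.abs (fst n) <= Z.of_nat h)%Z /\ (Z.of_nat (snd n) <= Z.of_nat h)%Z.
Proof.
  destruct n as [m n]. etransitivity; [apply (in_prod_iff (Zlist h) (seq 0 (h + 1)) m n)|].
  rewrite in_Zlist, in_seq. simpl. lia.
Qed.

Lemma length_box h : length (box h) = ((2 * h + 1) * (h + 1))%nat.
Proof.
  etransitivity; [apply (length_prod (Zlist h) (seq 0 (h + 1)))|].
  unfold Zlist. now rewrite length_map, !length_seq.
Qed.

Lemma bessel_box L g G h : torus_lip L g -> (forall x, Cmod (g x) <= G) ->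
  sumR (map (fun n => normsq (c2 (fst n) (Z.of_nat (snd n)) g)) (box h)) <= G * G.
Proof.
  intros H HG. unfold box. rewrite sumR_list_prod. simpl.
  eapply Rle_trans; [|apply (bessel2 L g G (Zlist h) (map Z.of_nat (seq 0 (h + 1)))); auto using NoDup_Zlist].
  - right. f_equal. apply map_ext. intros m. now rewrite map_map.
  - apply FinFun.Injective_map_NoDup; [intros x y; lia | apply seq_NoDup].
Qed.

(** Here [q n] is the squared modulus of the factor that one difference puts on mode [n]. Removing
    [k] such factors costs [16 ^ k] in the sum of squares. The box has [(2h+1)(h+1) <= 6 h^2]
    points, and [6 <= 3^2] gives the constant [3]. *)
Lemma half_annulus k G h (q : lattice -> R) (c : lattice -> C) l :
  (1 <= h)%nat -> 0 <= G -> NoDup l -> incl l (box h) -> (forall n, 0 <= q n) ->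
  (forall n, In n l -> / 16 <= q n) ->
  sumR (map (fun n => q n ^ k * normsq (c n)) (box h)) <= G * G ->
  sumR (map (fun n => Cmod (c n)) l) <= 3 * INR h * 4 ^ k * G.
Proof.
  intros Hh HG Hl Hi Hq0 Hq HB.
  assert (Hh' : 1 <= INR h) by (apply (le_INR 1); auto).
  assert (P4 : 0 < 4 ^ k) by (apply pow_lt; lra).
  apply Rsqr_incr_0_var; [|repeat apply Rmult_le_pos; lra]. unfold Rsqr.
  eapply Rle_trans; [apply sumR_cauchy_schwarz; intros; apply Cmod_ge_0|].
  assert (Len : INR (length l) <= 6 * (INR h * INR h)).
  { apply Rle_trans with (INR (length (box h))).
    - apply le_INR, NoDup_incl_length; auto.
    - rewrite length_box, mult_INR, !plus_INR, mult_INR. simpl. nra. }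
  assert (Q : sumR (map (fun n => Cmod (c n) * Cmod (c n)) l) <= 16 ^ k * (G * G)).
  { apply Rle_trans with (16 ^ k * sumR (map (fun n => q n ^ k * normsq (c n)) l)).
    - rewrite <- sumR_mult_l. apply sumR_le. intros n Hn. rewrite <- normsq_Cmod.
      assert (1 <= (16 * q n) ^ k) by (apply pow_R1_Rle; specialize (Hq n Hn); lra).
      rewrite Rpow_mult_distr in H. pose proof (normsq_nonneg (c n)).
      rewrite <- Rmult_assoc. nra.
    - apply Rmult_le_compat_l; [apply pow_le; lra|].
      eapply Rle_trans; [|exact HB]. apply sumR_incl; auto.
      intros n. apply Rmult_le_pos; [now apply pow_le | apply normsq_nonneg]. }
  apply Rle_trans with (6 * (INR h * INR h) * (16 ^ k * (G * G))).
  - apply Rmult_le_compat; auto; [apply pos_INR|].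
    apply (sumR_map_nonneg _ (fun n => Cmod (c n) * Cmod (c n))). intros; apply Rmult_le_pos; apply Cmod_ge_0.
  - replace (16 ^ k) with (4 ^ k * 4 ^ k) by (rewrite <- Rpow_mult_distr; f_equal; ring).
    replace (3 * INR h * 4 ^ k * G * (3 * INR h * 4 ^ k * G))
      with (9 * (INR h * INR h * (4 ^ k * 4 ^ k * (G * G)))) by ring.
    replace (6 * (INR h * INR h) * (4 ^ k * 4 ^ k * (G * G)))
      with (6 * (INR h * INR h * (4 ^ k * 4 ^ k * (G * G)))) by ring.
    assert (0 <= INR h * INR h * (4 ^ k * 4 ^ k * (G * G)))
      by (repeat apply Rmult_le_pos; lra). lra.
Qed.

(** [4 sin^2(z/2) >= z^2/4 >= 1/16], by [Rabs_le_sin_half]. *)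
Lemma normsq_cexpi_minus_1_ge z : / 2 <= Rabs z <= 1 -> / 16 <= normsq (Cminus (cexpi z) (RtoC 1)).
Proof.
  intros H. rewrite normsq_cexpi_minus_1. set (s := sin (z / 2)).
  assert (K : Rabs z <= 4 * Rabs s) by (apply Rabs_le_sin_half; pose proof PI2_1; lra).
  replace (s * s) with (Rabs s * Rabs s) by (rewrite <- Rabs_mult; apply Rabs_pos_eq; nra).
  nra.
Qed.

Definition annulus_const (k : nat) : R := 6 * 4 ^ S k.

Lemma half_range h z : (1 <= h)%nat -> (Z.of_nat h < 2 * Z.abs z)%Z -> (Z.abs z <= Z.of_nat h)%Z ->
  / 2 <= Rabs (IZR z * / INR h) <= 1.
Proof.
  intros Hh H1 H2. rewrite INR_IZR_INZ. apply IZR_lt in H1. apply IZR_le in H2.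
  rewrite mult_IZR in H1. rewrite abs_IZR in H1, H2.
  assert (Hp : 0 < IZR (Z.of_nat h)) by (apply IZR_lt; lia).
  rewrite Rabs_mult, (Rabs_pos_eq (/ _)) by (left; now apply Rinv_0_lt_compat).
  set (H := IZR (Z.of_nat h)) in *. set (r := Rabs (IZR z)) in *.
  split; apply (Rmult_le_reg_r H); auto; rewrite Rmult_assoc, Rinv_l, ?Rmult_1_r by lra; lra.
Qed.

(* The (k+1)-st difference with step 1/h multiplies every mode of the annulus by at least 4^-(k+1), and
   Cauchy-Schwarz over its O(h^2) lattice points costs one factor h. *)
Lemma annulus_bound k al A g h l : torus_smooth k al A g -> (1 <= h)%nat -> NoDup l ->
  (forall n, In n l -> ((Z.of_nat h < 2 * Z.abs (fst n))%Z \/ (Z.of_nat h < 2 * Z.of_nat (snd n))%Z) /\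
     In n (box h)) ->
  sumR (map (fun n => Cmod (cn n g)) l) <= annulus_const k * A * Rpower (INR h) (1 - INR k - al).
Proof.
  intros [HL HG H1 H2] Hh Hl Hn.
  assert (Hh' : 1 <= INR h) by (apply (le_INR 1); auto).
  set (t := / INR h).
  assert (Ht : 0 < t <= 1).
  { unfold t. split; [apply Rinv_0_lt_compat; lra|]. rewrite <- Rinv_1. apply Rinv_le_contravar; lra. }
  set (G := A * (t ^ k * Rpower t al)).
  assert (HG0 : 0 <= G) by (eapply Rle_trans; [apply Cmod_ge_0 | apply (H1 t (0, 0) Ht)]).
  assert (E : INR h * (t ^ k * Rpower t al) = Rpower (INR h) (1 - INR k - al)).
  { rewrite <- Rpower_pow by lra. rewrite <- Rpower_plus. unfold t, Rpower. rewrite ln_Rinv by lra.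
    rewrite <- (exp_ln (INR h)) at 1 by lra. rewrite <- exp_plus. f_equal. ring. }
  rewrite (map_ext _ (fun n => Cmod (c2 (fst n) (Z.of_nat (snd n)) g)))
    by (intros [m n]; now rewrite (cn_c2 A)).
  (* Modes with large first index are treated by differences in [x1]; the others have a large second
     index and are treated by differences in [x2]. The two halves give the [6 = 3 + 3] of
     [annulus_const]. *)
  set (p := fun n : lattice => Z.ltb (Z.of_nat h) (2 * Z.abs (fst n))).
  rewrite (sumR_filter _ _ p).
  apply Rle_trans with (3 * INR h * 4 ^ S k * G + 3 * INR h * 4 ^ S k * G).
  2:{ rewrite <- E. unfold G, annulus_const. right. ring. }
  apply Rplus_le_compat.
  - apply (half_annulus (S k) G h (fun n => normsq (Cminus (cexpi (IZR (fst n) * t)) (RtoC 1)))); auto.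
    + now apply NoDup_filter.
    + intros n Hp. apply filter_In in Hp. apply Hn, Hp.
    + intros; apply normsq_nonneg.
    + intros n Hp. apply filter_In in Hp. destruct Hp as [Hp1 Hp2]. apply Z.ltb_lt in Hp2.
      destruct (Hn n Hp1) as [_ Hb]. apply in_box in Hb.
      apply normsq_cexpi_minus_1_ge, half_range; auto; lia.
    + destruct (iter_fd1 A g t (S k) HL) as [K1 K2].
      rewrite (map_ext _ (fun n => normsq (c2 (fst n) (Z.of_nat (snd n)) (Nat.iter (S k) (fd1 t) g))))
        by (intros n; now rewrite K2).
      apply (bessel_box (2 ^ S k * A)); [exact K1 | intros x; now apply H1].
  - apply (half_annulus (S k) G h (fun n => normsq (Cminus (cexpi (IZR (Z.of_nat (snd n)) * t)) (RtoC 1)))); auto.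
    + now apply NoDup_filter.
    + intros n Hp. apply filter_In in Hp. apply Hn, Hp.
    + intros; apply normsq_nonneg.
    + intros n Hp. apply filter_In in Hp. destruct Hp as [Hp1 Hp2].
      unfold p in Hp2. apply Bool.negb_true_iff, Z.ltb_ge in Hp2.
      destruct (Hn n Hp1) as [Ho Hb]. apply in_box in Hb.
      apply normsq_cexpi_minus_1_ge, half_range; auto; lia.
    + destruct (iter_fd2 A g t (S k) HL) as [K1 K2].
      rewrite (map_ext _ (fun n => normsq (c2 (fst n) (Z.of_nat (snd n)) (Nat.iter (S k) (fd2 t) g))))
        by (intros n; now rewrite K2).
      apply (bessel_box (2 ^ S k * A)); [exact K1 | intros x; now apply H2].
Qed.

(** A mode outside the box of size [2 ^ J * h] has an index exceeding half of [2 ^ S J * h], so each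
    doubling of the box adds one annulus for [annulus_bound]. *)
Lemma dyadic_sum k al A g h J : torus_smooth k al A g -> (1 <= h)%nat -> forall l, NoDup l ->
  (forall n, In n l -> ((Z.of_nat h < 2 * Z.abs (fst n))%Z \/ (Z.of_nat h < 2 * Z.of_nat (snd n))%Z) /\
     In n (box (2 ^ J * h))) ->
  sumR (map (fun n => Cmod (cn n g)) l)
  <= sum_f_R0 (fun j => annulus_const k * A * Rpower (INR (2 ^ j * h)) (1 - INR k - al)) J.
Proof.
  intros Hg Hh. induction J as [|J IH]; intros l Hl Hn.
  - cbn [sum_f_R0]. replace (2 ^ 0 * h)%nat with h in * by (simpl; lia). now apply annulus_bound.
  - set (p := fun n : lattice => andb (Z.leb (Z.abs (fst n)) (Z.of_nat (2 ^ J * h)))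
                                   (Z.leb (Z.of_nat (snd n)) (Z.of_nat (2 ^ J * h)))).
    assert (E2 : Z.of_nat (2 ^ S J * h) = (2 * Z.of_nat (2 ^ J * h))%Z) by (rewrite Nat.pow_succ_r'; lia).
    assert (E1 : (1 <= 2 ^ J * h)%nat).
    { assert (2 ^ J <> 0)%nat by (apply Nat.pow_nonzero; lia). nia. }
    rewrite (sumR_filter _ _ p). simpl sum_f_R0. apply Rplus_le_compat.
    + apply IH; [now apply NoDup_filter|]. intros n Hi. apply filter_In in Hi. destruct Hi as [Hi Hp].
      split; [apply Hn, Hi|]. apply andb_prop in Hp. rewrite !Z.leb_le in Hp. now apply in_box.
    + apply (annulus_bound k al A g (2 ^ S J * h)); auto; [lia | now apply NoDup_filter |].
      intros n Hi. apply filter_In in Hi. destruct Hi as [Hi Hp].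
      split; [|apply Hn, Hi]. unfold p in Hp. rewrite E2.
      apply Bool.negb_true_iff, Bool.andb_false_iff in Hp. rewrite !Z.leb_gt in Hp. lia.
Qed.

Lemma geometric_bound q J : 0 <= q < 1 -> sum_f_R0 (fun j => q ^ j) J <= / (1 - q).
Proof.
  intros Hq. rewrite tech3 by lra. unfold Rdiv. rewrite <- (Rmult_1_l (/ (1 - q))) at 2.
  apply Rmult_le_compat_r; [left; apply Rinv_0_lt_compat; lra|].
  assert (0 <= q ^ S J) by (apply pow_le; lra). lra.
Qed.

Definition tail_const (k : nat) (al : R) : R :=
  annulus_const k * / (1 - Rpower 2 (1 - INR k - al)).

Lemma Rpower_2_lt_1 b : b < 0 -> 0 <= Rpower 2 b < 1.
Proof.
  intros Hb. split; [left; apply exp_pos|]. rewrite <- (Rpower_O 2) by lra. apply Rpower_lt; lra.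
Qed.

Lemma tail_bound k al A g h l : torus_smooth k al A g -> 1 < INR k + al -> (1 <= h)%nat -> NoDup l ->
  (forall n, In n l -> ((Z.of_nat h < 2 * Z.abs (fst n))%Z \/ (Z.of_nat h < 2 * Z.of_nat (snd n))%Z)) ->
  forall N, incl l (box N) ->
  sumR (map (fun n => Cmod (cn n g)) l) <= tail_const k al * A * Rpower (INR h) (1 - INR k - al).
Proof.
  intros Hg Hk Hh Hl Hn N Hi. set (b := 1 - INR k - al).
  assert (A0 : 0 <= A).
  { destruct Hg as [[H _ _ _] _ _ _]. specialize (H 0 1 0). rewrite Rminus_0_r, Rabs_R1 in H.
    pose proof (Cmod_ge_0 (Cminus (g (1, 0)) (g (0, 0)))). lra. }
  assert (Hh' : 1 <= INR h) by (apply (le_INR 1); auto).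
  eapply Rle_trans.
  - apply (dyadic_sum k al A g h N Hg Hh l Hl). intros n Hin. split; [now apply Hn|].
    specialize (Hi n Hin). apply in_box in Hi. apply in_box.
    (* Any number of doublings that covers the box of size [N] would do; [N] itself is enough, and
       the geometric bound does not depend on it. *)
    assert (N < 2 ^ N)%nat by (apply Nat.pow_gt_lin_r; lia). nia.
  - fold b. rewrite (sum_eq _ (fun j => Rpower 2 b ^ j * (annulus_const k * A * Rpower (INR h) b))).
    + rewrite <- scal_sum.
      assert (K : sum_f_R0 (fun j => Rpower 2 b ^ j) N <= / (1 - Rpower 2 b))
        by (apply geometric_bound, Rpower_2_lt_1; unfold b; lra).
      unfold tail_const. fold b.
      replace (annulus_const k * / (1 - Rpower 2 b) * A * Rpower (INR h) b)
        with (annulus_const k * A * Rpower (INR h) b * / (1 - Rpower 2 b)) by ring.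
      apply Rmult_le_compat_l; auto.
      apply Rmult_le_pos; [apply Rmult_le_pos; auto|left; apply exp_pos].
      unfold annulus_const. apply Rmult_le_pos; [lra | apply pow_le; lra].
    + intros j _. rewrite mult_INR, pow_INR. change (INR 2) with 2.
      rewrite <- Rpower_mult_distr by (try apply pow_lt; lra).
      replace (Rpower (2 ^ j) b) with (Rpower 2 b ^ j).
      * ring.
      * rewrite <- !Rpower_pow by (try apply exp_pos; lra). rewrite !Rpower_mult. f_equal. ring.
Qed.

(** * Partial sums compared with Fejer means *)

Lemma Cmod_e_n n x : Cmod (e_n n x) <= 2.
Proof.
  destruct n as [m [|n]]; unfold e_n; simpl snd; cbv iota; [rewrite Cmod_cexpi; lra|].
  eapply Rle_trans; [apply Cmod_triangle|]. rewrite Cmod_mult. simpl fst.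
  rewrite <- cexpi_PI_Z, !Cmod_cexpi. lra.
Qed.

Lemma weight_bounds h n z : (Z.abs z <= Z.of_nat n)%Z -> (n <= h)%nat ->
  0 <= weight h z <= 1 /\ 1 - weight h z <= INR n * / INR (S h).
Proof.
  intros Hz Hn. unfold weight. apply IZR_le in Hz. rewrite <- INR_IZR_INZ in Hz.
  apply le_INR in Hn. assert (0 <= IZR (Z.abs z)) by (apply IZR_le; lia).
  assert (HS : 0 < INR (S h)) by (apply lt_0_INR; lia). rewrite S_INR in *.
  assert (HI : 0 < / (INR h + 1)) by now apply Rinv_0_lt_compat.
  assert (E : (INR h + 1) * / (INR h + 1) = 1) by (apply Rinv_r; lra).
  replace ((INR h + 1 - IZR (Z.abs z)) / (INR h + 1)) with (1 - IZR (Z.abs z) * / (INR h + 1)) by (field; lra).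
  assert (0 <= IZR (Z.abs z) * / (INR h + 1)) by (apply Rmult_le_pos; lra).
  assert (IZR (Z.abs z) * / (INR h + 1) <= INR n * / (INR h + 1)) by (apply Rmult_le_compat_r; lra).
  assert (INR n * / (INR h + 1) <= 1) by nra. lra.
Qed.

(** The order of choices matters: [e] is fixed first to make [P * e] small, then [N] is taken large
    in terms of [/ e]. *)
Lemma le_of_limit X T P Q h : 0 <= P ->
  (forall e N, 0 < e -> (h <= N)%nat -> X <= T + P * e + (P * / e + Q) * / INR (S N)) -> X <= T.
Proof.
  intros HP H. apply le_epsilon. intros eps Heps.
  set (e := eps / (2 * (P + 1))).
  assert (He : 0 < e) by (apply Rdiv_lt_0_compat; lra).
  assert (Pe : P * e <= eps / 2).
  { apply Rle_trans with ((P + 1) * e); [nra|]. unfold e. right. field. lra. }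
  set (W := P * / e + Q).
  destruct (INR_unbounded (2 * W / eps)) as [N0 HN0].
  set (N := (h + N0)%nat). specialize (H e N He ltac:(lia)). fold W in H.
  assert (HS : 0 < INR (S N)) by (apply lt_0_INR; lia).
  assert (HN : 2 * W / eps < INR (S N)).
  { eapply Rlt_le_trans; [apply HN0|]. apply le_INR. unfold N. lia. }
  assert (K : W * / INR (S N) <= eps / 2).
  { apply (Rmult_le_reg_r (INR (S N))); auto. rewrite Rmult_assoc, Rinv_l, Rmult_1_r by lra.
    apply (Rmult_lt_compat_l (eps / 2)) in HN; [|lra].
    replace (eps / 2 * (2 * W / eps)) with W in HN by (field; lra). lra. }
  lra.
Qed.

(** Names the filter of [Omega], so that [Omega h] is convertible to [filter (in_disc h) (box h)]
    and can be compared with larger boxes. *)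
Definition in_disc (h : nat) (n : lattice) : bool :=
  Z.leb (fst n * fst n + Z.of_nat (snd n) * Z.of_nat (snd n)) (Z.of_nat h * Z.of_nat h).

(** The error has three pieces: the Fejer error, the defect [w - 1] of the weights on the disc, and
    the weighted modes outside it. For fixed [h] the first two vanish in the limit of [le_of_limit];
    the third is bounded by the tail uniformly in [N], with the [2] of [Cmod_e_n]. *)
Lemma partial_sum_bound k al A g h x : torus_smooth k al A g -> 1 < INR k + al -> (1 <= h)%nat ->
  Cmod (Cminus (g x) (lsum (fun n => Cmult (cn n g) (e_n n x)) (Omega h)))
  <= 2 * (tail_const k al * A * Rpower (INR h) (1 - INR k - al)).
Proof.
  intros Hg Hk Hh. set (T := tail_const k al * A * Rpower (INR h) (1 - INR k - al)).
  assert (HL : torus_lip A g) by apply Hg.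
  assert (A0 : 0 <= A).
  { destruct HL as [H _ _ _]. specialize (H 0 1 0). rewrite Rminus_0_r, Rabs_R1 in H.
    pose proof (Cmod_ge_0 (Cminus (g (1, 0)) (g (0, 0)))). lra. }
  set (Sh := sumR (map (fun n => Cmod (cn n g)) (Omega h))).
  apply (le_of_limit _ _ (24 * A) (4 * INR h * Sh) h); [lra|]. intros e N He HN.
  set (F := fun n => Cmult (cn n g) (e_n n x)).
  set (w := fun n : lattice => weight N (fst n) * weight N (Z.of_nat (snd n))).
  assert (EF : sigma2 N g x = lsum (fun n => Cmult (RtoC (w n)) (F n)) (box N)).
  { apply (sigma2_box N A); auto. apply (ts_glide k al A g Hg). }
  assert (EO : Permutation (filter (in_disc h) (box N)) (Omega h)).
  { apply NoDup_Permutation; [apply NoDup_filter, NoDup_box | apply (NoDup_filter (in_disc h)), (NoDup_box h) |].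
    intros n. change (Omega h) with (filter (in_disc h) (box h)). rewrite !filter_In, !in_box.
    unfold in_disc. rewrite Z.leb_le. split; intros [[B1 B2] B3]; (split; [split|]); auto; try lia; nia. }
  rewrite (lsum_filter _ _ (in_disc h)), (lsum_perm _ _ _ _ EO) in EF.
  set (out := filter (fun n => negb (in_disc h n)) (box N)) in *.
  set (R1 := lsum (fun n => Cmult (RtoC (w n - 1)) (F n)) (Omega h)).
  set (R2 := lsum (fun n => Cmult (RtoC (w n)) (F n)) out) in *.
  assert (E : Cminus (g x) (lsum F (Omega h)) = Cplus (Copp (Cminus (sigma2 N g x) (g x))) (Cplus R1 R2)).
  { rewrite EF. unfold R1. rewrite (lsum_ext_in _ (fun n => Cmult (RtoC (w n - 1)) (F n))
      (fun n => Cplus (Cmult (RtoC (w n)) (F n)) (Cmult (Copp (RtoC 1)) (F n)))).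
    - rewrite lsum_plus, lsum_mult_l. ring.
    - intros n _. rewrite RtoC_minus. ring. }
  assert (FB : forall n, Cmod (F n) <= 2 * Cmod (cn n g)).
  { intros n. unfold F. rewrite Cmod_mult. pose proof (Cmod_e_n n x). pose proof (Cmod_ge_0 (cn n g)). nra. }
  assert (B1 : Cmod R1 <= 4 * INR h * Sh * / INR (S N)).
  { eapply Rle_trans; [apply Cmod_lsum_le|].
    replace (4 * INR h * Sh * / INR (S N)) with ((4 * INR h * / INR (S N)) * Sh) by ring.
    unfold Sh. rewrite <- sumR_mult_l. apply sumR_le. intros n Hn.
    assert (Hb : In n (box h)) by (apply (filter_In (in_disc h)) in Hn; apply Hn).
    apply in_box in Hb. destruct Hb as [Hb1 Hb2].
    destruct (weight_bounds N h (fst n)) as [W1 W2]; auto.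
    destruct (weight_bounds N h (Z.of_nat (snd n))) as [W3 W4]; auto; [lia|].
    rewrite Cmod_mult, Cmod_R.
    assert (Rabs (w n - 1) <= 2 * (INR h * / INR (S N))).
    { unfold w. apply Rabs_le. split; nra. }
    specialize (FB n). pose proof (Cmod_ge_0 (F n)). pose proof (Cmod_ge_0 (cn n g)).
    pose proof (Rabs_pos (w n - 1)).
    apply Rle_trans with (2 * (INR h * / INR (S N)) * (2 * Cmod (cn n g))); [|right; ring].
    apply Rmult_le_compat; auto. }
  assert (B2 : Cmod R2 <= 2 * T).
  { eapply Rle_trans; [apply Cmod_lsum_le|].
    apply Rle_trans with (2 * sumR (map (fun n => Cmod (cn n g)) out)).
    - rewrite <- sumR_mult_l. apply sumR_le. intros n Hn.
      assert (Hb : In n (box N)) by (apply filter_In in Hn; apply Hn).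
      apply in_box in Hb. destruct Hb as [Hb1 Hb2].
      destruct (weight_bounds N N (fst n)) as [W1 _]; auto.
      destruct (weight_bounds N N (Z.of_nat (snd n))) as [W3 _]; auto; [lia|].
      assert (0 <= w n <= 1) by (unfold w; nra).
      rewrite Cmod_mult, Cmod_R, Rabs_pos_eq by lra.
      specialize (FB n). pose proof (Cmod_ge_0 (F n)). nra.
    - apply Rmult_le_compat_l; [lra|]. unfold T.
      apply (tail_bound k al A g h out Hg Hk Hh) with N.
      + apply NoDup_filter, NoDup_box.
      + intros n Hn. apply filter_In in Hn. destruct Hn as [_ Hn].
        unfold in_disc in Hn. apply Bool.negb_true_iff, Z.leb_gt in Hn.
        (* If both indices were at most [h/2] in modulus, the sum of their squares would be at most
           [h^2/2], inside the disc. *)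
        destruct (Z_lt_le_dec (Z.of_nat h) (2 * Z.abs (fst n))) as [|C1]; auto.
        destruct (Z_lt_le_dec (Z.of_nat h) (2 * Z.of_nat (snd n))) as [|C2]; auto.
        exfalso. rewrite <- (Z.abs_square (fst n)) in Hn. nia.
      + intros n Hn. apply filter_In in Hn. apply Hn. }
  pose proof (sigma2_approx N A g x e HL He) as B3.
  change (lsum (fun n => Cmult (cn n g) (e_n n x)) (Omega h)) with (lsum F (Omega h)). rewrite E.
  eapply Rle_trans; [apply Cmod_triangle|]. rewrite Cmod_opp.
  pose proof (Cmod_triangle R1 R2). lra.
Qed.

(** * Return to the sphere and infimum over extensions *)

Lemma circle_angle a b : a * a + b * b = 1 -> exists l, - PI <= l < PI /\ cos l = a /\ sin l = b.
Proof.
  intros H. pose proof PI_RGT_0. assert (Ha : -1 <= a <= 1) by nra.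
  pose proof (acos_bound a) as Hb. pose proof (cos_acos a Ha) as Hc.
  pose proof (sin_acos a Ha) as Hs. replace (1 - a²) with (b²) in Hs by (unfold Rsqr; lra).
  rewrite sqrt_Rsqr_abs in Hs.
  destruct (Rlt_dec b 0) as [Hneg|Hpos].
  - rewrite Rabs_left in Hs by auto. exists (- acos a). rewrite cos_neg, sin_neg.
    repeat split; try lra.
  - rewrite Rabs_pos_eq in Hs by lra. destruct (Req_dec (acos a) PI) as [e|ne].
    (* The half-open range excludes [PI], so the point [(-1, 0)] gets the angle [- PI]. *)
    + exists (- PI). rewrite e in Hc, Hs. rewrite cos_neg, sin_neg, Hc, Hs.
      rewrite sin_PI in Hs. repeat split; lra.
    + exists (acos a). repeat split; lra.
Qed.

(** [phi_inv] is chosen by [epsilon], so the claim amounts to surjectivity of [phi] on [phi_dom].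
    The poles are separate because the longitude is found by dividing by the radius [r] of the
    parallel. *)
Lemma phi_inv_spec xi : sphere xi -> phi (phi_inv xi) = xi.
Proof.
  intros H. unfold phi_inv.
  assert (Ex : exists p, phi_dom p /\ phi p = xi).
  { destruct xi as [[a b] c]. simpl in H.
    assert (Hc : -1 <= c <= 1) by nra.
    pose proof (acos_bound c) as Bc. pose proof (cos_acos c Hc) as Cc.
    pose proof (sin_acos c Hc) as Sc.
    set (r := sqrt (1 - c²)) in *.
    assert (Hr : r * r = a * a + b * b).
    { unfold r. rewrite sqrt_def; unfold Rsqr; nra. }
    assert (Hr0 : 0 <= r) by apply sqrt_pos.
    destruct (Req_dec r 0) as [e|ne].
    - rewrite e in Hr. assert (Ea : a = 0) by nra. assert (Eb : b = 0) by nra.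
      assert (Ec : c = 1 \/ c = -1) by (destruct (Rle_dec 0 c); [left | right]; nra).
      destruct Ec as [Ec|Ec]; subst.
      + exists (0, 0). split; [right; left; reflexivity|]. simpl. rewrite cos_0, sin_0. apply triple_eq; ring.
      + exists (0, PI). split; [right; right; reflexivity|]. simpl. rewrite cos_0, sin_0, cos_PI, sin_PI. apply triple_eq; ring.
    - destruct (circle_angle (a / r) (b / r)) as [l [Hl [El1 El2]]].
      { replace (a / r * (a / r) + b / r * (b / r)) with ((a * a + b * b) / (r * r)) by (field; auto).
        rewrite <- Hr. field; auto. }
      exists (l, acos c). split.
      + left. simpl. split; auto. split.
        * destruct (proj1 Bc) as [|e]; auto. exfalso. rewrite <- e, sin_0 in Sc. auto.
        * destruct (proj2 Bc) as [|e]; auto. exfalso. rewrite e, sin_PI in Sc. auto.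
      + simpl. rewrite El1, El2, Sc, Cc. apply triple_eq; [field; auto | field; auto | reflexivity]. }
  apply (epsilon_spec (inhabits (0, 0)) (fun p => phi_dom p /\ phi p = xi) Ex).
Qed.

Lemma K_h_error U k al fs f h : open3 U -> (forall x, sphere x -> U x) -> 0 <= al <= 1 ->
  (1 <= k)%nat -> 1 < INR k + al -> Ckalpha U k al fs -> (forall x, sphere x -> fs x = f x) ->
  (1 <= h)%nat ->
  supnorm_S2 (fun xi => Cminus (f xi) (K_h h f xi))
  <= 4 * tail_const k al * chain_const k * ext_value k al fs * Rpower (INR h) (1 - INR k - al).
Proof.
  intros HU HS Hal Hk Hka Hfs Hf Hh.
  pose proof (tilde_smooth U k al fs f HU HS Hal Hk Hfs Hf) as Hg.
  assert (K : forall xi, sphere xi -> Cmod (Cminus (f xi) (K_h h f xi))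
    <= 4 * tail_const k al * chain_const k * ext_value k al fs * Rpower (INR h) (1 - INR k - al)).
  { intros xi Hxi. pose proof (partial_sum_bound k al _ (tilde f) h (phi_inv xi) Hg Hka Hh) as P.
    unfold tilde at 1 in P. rewrite (phi_inv_spec xi Hxi) in P.
    eapply Rle_trans; [exact P|]. right. ring. }
  apply supR_le.
  (* The bound is nonnegative because it dominates a modulus at one point of the sphere. *)
  - eapply Rle_trans; [apply Cmod_ge_0 | apply (K _ north_pole)].
  - intros r [xi [Hxi ->]]. auto.
Qed.

Lemma tail_const_pos k al : 1 < INR k + al -> 0 < tail_const k al.
Proof.
  intros H. unfold tail_const, annulus_const.
  assert (Rpower 2 (1 - INR k - al) < 1) by (apply Rpower_2_lt_1; lra).
  apply Rmult_lt_0_compat; [|apply Rinv_0_lt_compat; lra].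
  apply Rmult_lt_0_compat; [lra | apply pow_lt; lra].
Qed.

(** Passes from a bound for each extension to the norm: [X / M] is a lower bound, hence below the
    infimum, and finiteness lets [real] return the infimum itself. *)
Lemma le_mult_Glb (P : R -> Prop) X M : 0 < M -> is_finite (Glb_Rbar P) ->
  (forall r, P r -> X <= M * r) -> X <= M * real (Glb_Rbar P).
Proof.
  intros HM Hfin H. destruct (Glb_Rbar_correct P) as [_ G].
  assert (K : Rbar_le (Finite (X / M)) (Glb_Rbar P)).
  { apply G. intros r Hr. simpl. apply (Rmult_le_reg_l M); auto.
    replace (M * (X / M)) with X by (field; lra). auto. }
  rewrite <- Hfin in K. simpl in K. apply (Rmult_le_compat_l M) in K; [|lra].
  replace (M * (X / M)) with X in K by (field; lra). exact K.
Qed.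

Lemma K_h_error_norm k al : 0 <= al <= 1 -> (1 <= k)%nat -> 1 < INR k + al ->
  exists M, forall f, is_finite (norm_S2_raw k al f) -> forall h, (1 <= h)%nat ->
    supnorm_S2 (fun xi => Cminus (f xi) (K_h h f xi))
    <= M * real (norm_S2_raw k al f) * Rpower (INR h) (1 - INR k - al).
Proof.
  intros Hal Hk Hka. exists (4 * tail_const k al * chain_const k). intros f Hfin h Hh.
  set (p := Rpower (INR h) (1 - INR k - al)). assert (Hp : 0 < p) by apply exp_pos.
  pose proof (tail_const_pos k al Hka). pose proof (chain_const_ge k).
  replace (4 * tail_const k al * chain_const k * real (norm_S2_raw k al f) * p)
    with (4 * tail_const k al * chain_const k * p * real (norm_S2_raw k al f)) by ring.
  apply le_mult_Glb; auto.
  - apply Rmult_lt_0_compat; [|lra]. apply Rmult_lt_0_compat; lra.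
  - intros r (U & fs & HU & HS & Hfs & Hf & ->).
    pose proof (K_h_error U k al fs f h HU HS Hal Hk Hka Hfs Hf Hh) as K. fold p in K. lra.
Qed.

Theorem theorem5p9 :
  forall (k : nat) (alpha : R), (1 <= k)%nat -> 0 < alpha <= 1 ->
  exists M : R, forall f : R3 -> C, in_Ckalpha_S2 k alpha f ->
    forall h : nat, (1 <= h)%nat ->
      supnorm_S2 (fun xi => Cminus (f xi) (K_h h f xi))
      <= M * real (norm_Ckalpha_S2 k alpha f) * Rpower (INR h) (1 - INR k - alpha).
Proof.
  intros k alpha Hk Ha. unfold in_Ckalpha_S2, norm_Ckalpha_S2.
  assert (Hk' : 1 <= INR k) by (apply (le_INR 1); auto).
  destruct (Req_EM_T alpha 1) as [->|_].
  (* The pairs [(k, 1)] and [(S k, 0)] give the same exponent, so the convention for [alpha = 1]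
     loses nothing in the rate. *)
  - replace (1 - INR k - 1) with (1 - INR (S k) - 0) by (rewrite S_INR; ring).
    apply K_h_error_norm; [lra | lia | rewrite S_INR; lra].
  - apply K_h_error_norm; [lra | lia | lra].
Qed.
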